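(* Run Algorithm 1 (described in the context) with the parameters listed in the context. Then there is a constant $C>0$, independent of $\varepsilon$ (depending only on the problem data, the oracle variance bound $\sigma^2$, $\rho$ and the initial point), such that for every $\varepsilon\in(0,1]$, with $T=\lceil C\varepsilon^{-4}\rceil$ (so $T=\Theta(\varepsilon^{-4})$) and $t^*$ selected uniformly at random from $\{1,\dots,T\}$ (independently of the run of the algorithm), $$\mathbb{E}\|\nabla\Psi(z_{t^*})\|\le\varepsilon .$$ Since each iteration uses a single stochastic gradient, the stochastic oracle complexity is $O(\varepsilon^{-4})$.
   Context: Problem: minimize $f(x)$ over $x\in X$ subject to $Ax=b$, where $f:\mathbb{R}^n\to\mathbb{R}$, $A\in\mathbb{R}^{m\times n}$ is nonzero, $b\in\mathbb{R}^m$, $X=\{x\in\mathbb{R}^n: Hx\le h\}$ is a polyhedral set (onto which one can project), and $\{x\in X: Ax=b\}\neq\emptyset$. Assumptions: $f$ is $L_f$-smooth ($\nabla f$ is $L_f$-Lipschitz) and $f(x)\ge\underline f>-\infty$ for all $x\in X$ with $Ax=b$. There is a stochastic gradient oracle $F(x,\xi)$, $\xi\sim\Xi$, with $\mathbb{E}_\xi[F(x,\xi)]=\nabla f(x)$ and $\mathbb{E}_\xi\|F(x,\xi)-\nabla f(x)\|^2\le\sigma^2$ for every $x$. Notation: $\|A\|$ is the operator norm, $\mathrm{proj}_X$ the Euclidean projection onto $X$. For $\rho\ge0$: $L_\rho(x,y)=f(x)+\langle Ax-b,y\rangle+\frac\rho2\|Ax-b\|^2$; $K(x,y,z)=L_\rho(x,y)+\frac\mu2\|x-z\|^2$;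 $x^*(y,z)=\mathrm{argmin}_{x\in X}K(x,y,z)$; $\bar x^*(z)=\mathrm{argmin}_{x\in X,\,Ax=b}\{f(x)+\frac\mu2\|x-z\|^2\}$; and the Moreau envelope $\Psi(z)=\min_{x\in X,\,Ax=b}\{f(x)+\frac\mu2\|x-z\|^2\}$. Known global error bound: for $\mu>L_f$ there is a finite constant $\bar\sigma>0$, depending only on $L_f+\rho\|A\|^2+\mu$, $\mu-L_f$, $A$ and $H$, such that $\|x^*(y,z)-\bar x^*(z)\|\le\bar\sigma\|Ax^*(y,z)-b\|$ for all $y,z$. Algorithm 1: choose $x_0=z_0\in X$, $y_0\in\mathbb{R}^m$, $\rho\ge0$. For $t=0,\dots,T-1$: $y_{t+1}=y_t+\eta(Ax_t-b)$; sample $\xi_t\sim\Xi$ i.i.d. and form $G(x_t,y_{t+1},z_t,\xi_t)=F(x_t,\xi_t)+A^\top y_{t+1}+\rho A^\top(Ax_t-b)+\mu(x_t-z_t)$, an unbiased estimate of $\nabla_xK(x_t,y_{t+1},z_t)$; $x_{t+1}=\mathrm{proj}_X(x_t-\tau G(x_t,y_{t+1},z_t,\xi_t))$; $z_{t+1}=z_t+\beta(x_t-z_t)$. Parameters: $\mu=\max\{2,4L_f\}$, $\lambda=L_K=L_f+\rho\|A\|^2+\mu$, $\tau=\frac{1}{6\lambda^2\sqrt T}$, $\eta=\min\left\{\frac{2\mu+\rho\|A\|}{4\|A\|^4},\frac{\tau}{200\|A\|^2},\frac{\tau(2\mu+\rho\|A\|^2)}{20\|A\|^2}\right\}$, $\beta=\min\left\{\frac{\tau}{100},\frac{1}{50\lambda},\frac{\eta}{36\mu\bar\sigma^2}\right\}$.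 *)

(* Defs.v *)
From HB Require Import structures.
From mathcomp Require Import all_boot all_order all_algebra.
From mathcomp Require Import all_classical all_reals all_analysis.

Set Implicit Arguments.
Unset Strict Implicit.
Unset Printing Implicit Defensive.

Import Order.TTheory GRing.Theory Num.Theory.
Import numFieldNormedType.Exports.

Local Open Scope classical_set_scope.
Local Open Scope ring_scope.

(* The norm that MathComp-Analysis puts on 'cV[R]_n is the sup norm. It induces
   the same topology, Borel sets and derivatives as the Euclidean norm; every
   quantitative norm below is the Euclidean one, [enorm]. *)

Definition dot {R : realType} {n : nat} (u v : 'cV[R]_n) : R :=
  (u^T *m v) 0 0.

Definition enorm {R : realType} {n : nat} (v : 'cV[R]_n) : R :=
  Num.sqrt (dot v v).

Definition opnorm {R : realType} {m n : nat} (A : 'M[R]_(m, n)) : R :=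
  sup [set enorm (A *m v) | v in [set v : 'cV[R]_n | enorm v <= 1]].

Definition grad {R : realType} {n : nat} (f : 'cV[R]_n -> R) (x : 'cV[R]_n) :
  'cV[R]_n := \col_i 'D_(delta_mx i 0) f x.

Definition smooth {R : realType} {n : nat} (L : R) (f : 'cV[R]_n -> R) : Prop :=
  (forall x, differentiable f x) /\
  (forall x y, enorm (grad f x - grad f y) <= L * enorm (x - y)).

(* A chosen minimizer of g over D, with junk value 0 when there is none. *)
Definition argmin {R : realType} {n : nat}
    (D : set 'cV[R]_n) (g : 'cV[R]_n -> R) : 'cV[R]_n :=
  xget 0 [set x | D x /\ forall u, D u -> g x <= g u].

Definition proj {R : realType} {n : nat} (D : set 'cV[R]_n) (v : 'cV[R]_n) :
  'cV[R]_n := argmin D (fun u => enorm (u - v)).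

Section Problem.
Context {R : realType} {n m k : nat}.
Context (f : 'cV[R]_n -> R) (A : 'M[R]_(m, n)) (b : 'cV[R]_m).
Context (H : 'M[R]_(k, n)) (h : 'cV[R]_k).

Definition polyhedron : set 'cV[R]_n :=
  [set x | forall i, (H *m x) i 0 <= h i 0].

Definition feasible : set 'cV[R]_n := polyhedron `&` [set x | A *m x = b].

Definition auglag (rho : R) (x : 'cV[R]_n) (y : 'cV[R]_m) : R :=
  f x + dot (A *m x - b) y + rho / 2 * enorm (A *m x - b) ^+ 2.

Definition proxlag (rho mu : R) (x : 'cV[R]_n) (y : 'cV[R]_m) (z : 'cV[R]_n) :
  R := auglag rho x y + mu / 2 * enorm (x - z) ^+ 2.

Definition xstar (rho mu : R) (y : 'cV[R]_m) (z : 'cV[R]_n) : 'cV[R]_n :=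
  argmin polyhedron (fun x => proxlag rho mu x y z).

Definition proxobj (mu : R) (z x : 'cV[R]_n) : R :=
  f x + mu / 2 * enorm (x - z) ^+ 2.

Definition xbarstar (mu : R) (z : 'cV[R]_n) : 'cV[R]_n :=
  argmin feasible (proxobj mu z).

Definition moreau (mu : R) (z : 'cV[R]_n) : R :=
  inf [set proxobj mu z x | x in feasible].

Definition error_bound (rho mu sbar : R) : Prop :=
  forall y z, enorm (xstar rho mu y z - xbarstar mu z) <=
              sbar * enorm (A *m xstar rho mu y z - b).

(* [queries] counts the calls made so far to the stochastic oracle. *)
Record state := State {
  xs : 'cV[R]_n; ys : 'cV[R]_m; zs : 'cV[R]_n; queries : nat }.

Section Algorithm.
Context {S : Type} (F : 'cV[R]_n -> S -> 'cV[R]_n).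
Context (rho mu tau eta beta : R).

Definition gradest (x : 'cV[R]_n) (y : 'cV[R]_m) (z : 'cV[R]_n) (s : S) :
  'cV[R]_n :=
  F x s + A^T *m y + rho *: (A^T *m (A *m x - b)) + mu *: (x - z).

Definition step (st : state) (s : S) : state :=
  let: State x y z q := st in
  let y' := y + eta *: (A *m x - b) in
  State (proj polyhedron (x - tau *: gradest x y' z s))
        y'
        (z + beta *: (x - z))
        q.+1.

Fixpoint run (x0 : 'cV[R]_n) (y0 : 'cV[R]_m) (samples : nat -> S) (t : nat) :
  state :=
  if t is t'.+1 then step (run x0 y0 samples t') (samples t')
  else State x0 y0 x0 0.

End Algorithm.
End Problem.

Section Stepsizes.
Context {R : realType} {m n : nat} (A : 'M[R]_(m, n)) (Lf rho sbar : R).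

Definition mu_par : R := Num.max 2 (4 * Lf).

Definition lambda_par : R := Lf + rho * opnorm A ^+ 2 + mu_par.

Definition tau_par (T : nat) : R :=
  (6 * lambda_par ^+ 2 * Num.sqrt T%:R)^-1.

(* The first term has [opnorm A], not its square, in the numerator. *)
Definition eta_par (T : nat) : R :=
  Num.min ((2 * mu_par + rho * opnorm A) / (4 * opnorm A ^+ 4))
  (Num.min (tau_par T / (200 * opnorm A ^+ 2))
           (tau_par T * (2 * mu_par + rho * opnorm A ^+ 2)
              / (20 * opnorm A ^+ 2))).

Definition beta_par (T : nat) : R :=
  Num.min (tau_par T / 100)
  (Num.min (50 * lambda_par)^-1 (eta_par T / (36 * mu_par * sbar ^+ 2))).

End Stepsizes.

(* The oracle is jointly measurable in (x, s), for the Borel sets of 'cV[R]_n,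
   so that the iterates of the algorithm are random variables. *)
Definition stochastic_oracle {R : realType} {n : nat} (f : 'cV[R]_n -> R)
    (sigma : R) {d : measure_display} {S : measurableType d}
    (Xi : probability S R) (F : 'cV[R]_n -> S -> 'cV[R]_n) : Prop :=
  [/\ forall i, measurable_fun
        [set: (g_sigma_algebraType (@open 'cV[R]_n) * S)%type]
        (fun p => F p.1 p.2 i 0),
      forall x i, Xi.-integrable [set: S] (fun s => (F x s i 0)%:E),
      forall x i, ('E_Xi[fun s => (F x s i 0)%R] = (grad f x i 0)%:E)%E &
      forall x, ('E_Xi[fun s => (enorm (F x s - grad f x) ^+ 2)%R]
                   <= (sigma ^+ 2)%:E)%E].

Section Sampling.
Context {R : realType} {d dS : measure_display}.
Context {Omega : measurableType d} {S : measurableType dS}.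
Context (P : probability Omega R).

Definition iid (T : nat) (xi : nat -> {RV P >-> S}) (Xi : probability S R) :
  Prop :=
  (forall t, (t < T)%N -> forall B, measurable B ->
     distribution P (xi t) B = Xi B) /\
  (forall (J : {set 'I_T}) (B : 'I_T -> set S),
     (forall t, measurable (B t)) ->
     P (\bigcap_(t in [set` J]) (xi t @^-1` B t)) =
     (\prod_(t in J) P (xi t @^-1` B t))%E).

Definition sigma_samples (T : nat) (xi : nat -> {RV P >-> S}) :
  set (set Omega) :=
  <<s \bigcup_(t in `I_T) preimage_set_system setT (xi t) measurable >>.

Definition uniform_index (T : nat) (tstar : {RV P >-> nat}) : Prop :=
  (forall w, (1 <= tstar w <= T)%N) /\
  (forall t, (1 <= t <= T)%N -> P (tstar @^-1` [set t]) = (T%:R^-1)%:E).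

Definition independent_of_samples (T : nat) (tstar : {RV P >-> nat})
    (xi : nat -> {RV P >-> S}) : Prop :=
  forall (D : set nat) (E : set Omega), sigma_samples T xi E ->
    P (tstar @^-1` D `&` E) = (P (tstar @^-1` D) * P E)%E.

End Sampling.

(* Main.v *)
(** Let V(x, y, z) = 2 Psi(z) - K(x*(y, z), y, z) + |x - x*(y, z)|^2, which is at
    least Psi(z).  One iteration contracts x towards x*(y', z), increases the dual
    value K(x*(y, z), y, z) by about eta |A x*(y', z) - b|^2, and moves z along a
    descent direction of Psi, because grad Psi(z) = mu (z - xbar*(z)).  The error
    bound compares x* and xbar* at the cost of the dual gain, so that
      V' <= V - (mu beta / 2) |z - xbar*(z)|^2 + noise,
    where the noise, |u - tau e|^2 - |u|^2 up to a factor at most 2 with u determined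
    by the past, has conditional expectation at most 2 tau^2 sigma^2.  Conditioning
    on the past is Tonelli's theorem for the product law of (state, sample), obtained
    from independence by a pi-lambda argument.  Summing over t, and using that beta
    and tau are of order T^(-1/2), the average of E|grad Psi(z_t)|^2 is
    O(T^(-1/2)); Young's inequality |g| <= eps/2 + |g|^2 / (2 eps) concludes. *)

Require Import Defs.
From HB Require Import structures.
From mathcomp Require Import all_boot all_order all_algebra.
From mathcomp Require Import all_classical all_reals all_analysis.
From mathcomp Require Import measurable_realfun.
From mathcomp Require Import ring lra.

Set Implicit Arguments.
Unset Strict Implicit.
Unset Printing Implicit Defensive.

Import Order.TTheory GRing.Theory Num.Theory.
Import numFieldNormedType.Exports.

Local Open Scope classical_set_scope.
Local Open Scope ring_scope.

(** The factor 2 in V has two uses. By weak duality one copy of Psi absorbs -K(x*(y, z), y, z),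
    which keeps V bounded below. When z moves, the direction 2 mu (z - xbar*(z)) - mu (z - x*(y',
    z')) equals mu (z - xbar*(z)) up to mu (x*(y', z') - xbar*(z)), which the drift and error bounds
    control. The reference point of an iteration is w = x*(y', z), with new y and old z, because the
    x step is a gradient step for K(., y', z). Moving the reference from x*(y, z) to w and then to
    x*(y', z') costs factors 1/tau, affordable because eta and beta are O(tau). Existence of the
    minimizers, their Lipschitz dependence on parameters and the gradient of Psi all come from one
    notion, two-sided quadratic bounds around a candidate gradient. The lower bound of f is
    subtracted from V and inequalities between expectations are kept additive, so all these
    integrands are nonnegative; integrability is proved only for the oracle noise. *)

Section Euclidean.
Context {R : realType}.
Implicit Types n m : nat.

(** * Euclidean inner product, norm and operator norm *)

Lemma dotE n (u v : 'cV[R]_n) : dot u v = \sum_i u i 0 * v i 0.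
Proof. by rewrite /dot mxE; apply: eq_bigr => i _; rewrite mxE. Qed.

Lemma dotC n (u v : 'cV[R]_n) : dot u v = dot v u.
Proof. by rewrite !dotE; apply: eq_bigr => i _; rewrite mulrC. Qed.

Lemma dotDl n (u v w : 'cV[R]_n) : dot (u + v) w = dot u w + dot v w.
Proof. by rewrite /dot linearD mulmxDl mxE. Qed.

Lemma dotDr n (u v w : 'cV[R]_n) : dot w (u + v) = dot w u + dot w v.
Proof. by rewrite /dot mulmxDr mxE. Qed.

Lemma dotZl n c (u w : 'cV[R]_n) : dot (c *: u) w = c * dot u w.
Proof. by rewrite dotE dotE mulr_sumr; apply: eq_bigr => i _; rewrite mxE mulrA. Qed.

Lemma dotZr n c (u w : 'cV[R]_n) : dot w (c *: u) = c * dot w u.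
Proof. by rewrite dotC dotZl dotC. Qed.

Lemma dotNl n (u w : 'cV[R]_n) : dot (- u) w = - dot u w.
Proof. by rewrite -scaleN1r dotZl mulN1r. Qed.

Lemma dotNr n (u w : 'cV[R]_n) : dot w (- u) = - dot w u.
Proof. by rewrite dotC dotNl dotC. Qed.

Lemma dot0l n (w : 'cV[R]_n) : dot 0 w = 0.
Proof. by rewrite -(scale0r 0) dotZl mul0r. Qed.

Definition dot_lin := (dotDl, dotDr, dotNl, dotNr, dotZl, dotZr).

Lemma dot_trmx m n (A : 'M[R]_(m, n)) (x : 'cV_n) (y : 'cV_m) :
  dot x (A^T *m y) = dot (A *m x) y.
Proof. by rewrite /dot trmx_mul mulmxA. Qed.

Lemma dot_ge0 n (v : 'cV[R]_n) : 0 <= dot v v.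
Proof. by rewrite dotE sumr_ge0// => i _; rewrite -expr2 sqr_ge0. Qed.

Lemma enorm_ge0 n (v : 'cV[R]_n) : 0 <= enorm v.
Proof. exact: sqrtr_ge0. Qed.

Lemma enorm_sqr n (v : 'cV[R]_n) : enorm v ^+ 2 = dot v v.
Proof. by rewrite sqr_sqrtr ?dot_ge0. Qed.

Lemma ler_enorm n (v : 'cV[R]_n) c : 0 <= c -> dot v v <= c ^+ 2 -> enorm v <= c.
Proof. by move=> c0 vc; rewrite -(@ler_pXn2r _ 2)// ?nnegrE ?enorm_ge0// enorm_sqr. Qed.

Lemma enorm_le n m (u : 'cV[R]_n) (v : 'cV[R]_m) :
  (enorm u <= enorm v) = (dot u u <= dot v v).
Proof. by rewrite -(@ler_pXn2r _ 2)// ?nnegrE ?enorm_ge0// !enorm_sqr. Qed.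

Lemma enorm0 n : enorm (0 : 'cV[R]_n) = 0.
Proof. by rewrite /enorm dot0l sqrtr0. Qed.

Lemma enorm_eq0 n (v : 'cV[R]_n) : enorm v = 0 -> v = 0.
Proof.
move=> /(congr1 (fun t => t ^+ 2)); rewrite expr0n enorm_sqr dotE => /eqP.
rewrite psumr_eq0; last by move=> i _; rewrite -expr2 sqr_ge0.
move=> /allP v0; apply/matrixP => i j; rewrite ord1 mxE.
by have := v0 i (mem_index_enum _); rewrite -expr2 sqrf_eq0 => /eqP.
Qed.

Lemma enormN n (v : 'cV[R]_n) : enorm (- v) = enorm v.
Proof. by rewrite /enorm !dot_lin opprK. Qed.

Lemma enormB n (u v : 'cV[R]_n) : enorm (u - v) = enorm (v - u).
Proof. by rewrite -enormN opprB. Qed.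

Lemma enormZ n c (v : 'cV[R]_n) : enorm (c *: v) = `|c| * enorm v.
Proof. by rewrite /enorm !dot_lin mulrA -expr2 sqrtrM ?sqr_ge0// sqrtr_sqr. Qed.

Lemma cauchy_schwarz n (u v : 'cV[R]_n) : dot u v <= enorm u * enorm v.
Proof.
have [u0|u0] := eqVneq (enorm u) 0.
  by rewrite (enorm_eq0 u0) dot0l mulr_ge0 ?enorm_ge0.
have [v0|v0] := eqVneq (enorm v) 0.
  by rewrite (enorm_eq0 v0) dotC dot0l mulr_ge0 ?enorm_ge0.
have up : 0 < enorm u by rewrite lt_def u0 enorm_ge0.
have vp : 0 < enorm v by rewrite lt_def v0 enorm_ge0.
have := dot_ge0 (enorm v *: u - enorm u *: v).
rewrite !dot_lin (dotC v u) -!enorm_sqr.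
set t := (X in 0 <= X).
have -> : t = 2 * (enorm u * enorm v) * (enorm u * enorm v - dot u v) by rewrite /t; ring.
by rewrite pmulr_rge0 ?subr_ge0// !mulr_gt0.
Qed.

Lemma dot_ge_enorm n (u v : 'cV[R]_n) : - (enorm u * enorm v) <= dot u v.
Proof. by rewrite lerNl -dotNl -(enormN u) cauchy_schwarz. Qed.

Lemma enorm_triangle n (u v : 'cV[R]_n) : enorm (u + v) <= enorm u + enorm v.
Proof.
apply: ler_enorm; first by rewrite addr_ge0 ?enorm_ge0.
rewrite !dot_lin (dotC v u) sqrrD !enorm_sqr.
have := cauchy_schwarz u v; lra.
Qed.

Lemma young n (u v : 'cV[R]_n) c : 0 < c -> dot u v <= c * dot u u + (4 * c)^-1 * dot v v.
Proof.
move=> c0.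
have := dot_ge0 ((2 * c) *: u - v); rewrite !dot_lin (dotC v u) => H.
rewrite -(@ler_pM2l _ (4 * c)) ?mulr_gt0// mulrDr mulrA mulrA mulfV ?lt0r_neq0 ?mulr_gt0//.
by lra.
Qed.

Lemma sqr_normD_le n (u v : 'cV[R]_n) c : 0 < c ->
  dot (u + v) (u + v) <= (1 + c) * dot u u + (1 + c^-1) * dot v v.
Proof.
move=> c0; have := dot_ge0 (c *: u - v); rewrite !dot_lin (dotC v u) => H.
rewrite -subr_ge0 -(pmulr_rge0 _ c0).
have -> : c * ((1 + c) * dot u u + (1 + c^-1) * dot v v -
   (dot u u + dot u v + (dot u v + dot v v))) =
   c * (c * dot u u) - c * dot u v + (- (c * dot u v) - - (c * c^-1 * dot v v)) by ring.
by rewrite mulfV ?lt0r_neq0// mul1r; lra.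
Qed.

Lemma mx_norm_le_enorm n (v : 'cV[R]_n) : `|v| <= enorm v.
Proof.
rewrite [leLHS]/Num.norm/= mx_normrE; apply/bigmax_leP; split; first exact: enorm_ge0.
move=> [i j] _ /=; rewrite ord1 -(@ler_pXn2r _ 2)// ?nnegrE ?enorm_ge0// enorm_sqr dotE.
rewrite (bigD1 i)//= -expr2 real_normK ?num_real// lerDl sumr_ge0// => k _.
by rewrite -expr2 sqr_ge0.
Qed.

Lemma coord_le_mx_norm m n (v : 'M[R]_(m, n)) i j : `|v i j| <= `|v|.
Proof.
rewrite [leRHS]/Num.norm/= mx_normrE; apply/bigmax_geP; right => /=.
by exists (i, j).
Qed.

(** The factor n in place of sqrt n suffices, since only continuity and differentiability are drawn
    from this comparison. *)
Lemma enorm_le_mx_norm n (v : 'cV[R]_n) : enorm v <= n%:R * `|v|.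
Proof.
apply: ler_enorm; first by rewrite mulr_ge0.
rewrite dotE (@le_trans _ _ (\sum_(i < n) `|v| ^+ 2))//.
  apply: ler_sum => i _; rewrite -expr2 -real_normK ?num_real//.
  by rewrite lerXn2r ?nnegrE// coord_le_mx_norm.
rewrite sumr_const card_ord exprMn -[leLHS]mulr_natl ler_wpM2r ?sqr_ge0//.
by rewrite -natrX ler_nat; case: n {v} => // n; rewrite expnS expn1 leq_pmulr.
Qed.

Lemma continuous_of_lip (V W : normedModType R) (g : V -> W) (c : R) :
  (forall u v, `|g u - g v| <= c * `|u - v|) -> continuous g.
Proof.
move=> gc x; apply/cvgrPdist_lt => e e0; near=> y.
apply: le_lt_trans (gc x y) _.
apply: (@le_lt_trans _ _ ((`|c| + 1) * `|x - y|)).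
  by rewrite ler_wpM2r// (le_trans (ler_norm c))// lerDl.
rewrite mulrC -ltr_pdivlMr ?ltr_wpDl//.
near: y; apply: cvgr_dist_lt => //.
by rewrite divr_gt0// ltr_wpDl.
Unshelve. all: by end_near. Qed.

Lemma continuous_of_elip n m (g : 'cV[R]_n -> 'cV[R]_m) (c : R) : 0 <= c ->
  (forall u v, enorm (g u - g v) <= c * enorm (u - v)) -> continuous g.
Proof.
move=> c0 gc; apply: (@continuous_of_lip _ _ g (c * n%:R)) => u v.
rewrite (le_trans (mx_norm_le_enorm _))// (le_trans (gc u v))// -mulrA.
by rewrite ler_wpM2l// enorm_le_mx_norm.
Qed.

(** Cauchy-Schwarz on each row, with the Frobenius norm of A as constant. The bound makes the
    supremum in [opnorm] a genuine one. *)
Lemma opnorm_ub m n (A : 'M[R]_(m, n)) : exists2 c, 0 <= c &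
  forall v, enorm (A *m v) <= c * enorm v.
Proof.
pose c := Num.sqrt (\sum_i dot (row i A)^T (row i A)^T).
have S0 : 0 <= \sum_i dot (row i A)^T (row i A)^T by rewrite sumr_ge0// => i _; exact: dot_ge0.
exists c => [|v]; first exact: sqrtr_ge0.
apply: ler_enorm; first by rewrite mulr_ge0 ?sqrtr_ge0 ?enorm_ge0.
rewrite exprMn sqr_sqrtr// mulr_suml dotE; apply: ler_sum => i _.
have -> : (A *m v) i 0 = dot (row i A)^T v.
  by rewrite dotE mxE; apply: eq_bigr => j _; rewrite !mxE.
rewrite -expr2 -real_normK ?num_real// -enorm_sqr -exprMn lerXn2r ?nnegrE//.
  by rewrite mulr_ge0 ?enorm_ge0.
by rewrite ler_norml cauchy_schwarz dot_ge_enorm.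
Qed.

Lemma opnorm_has_sup m n (A : 'M[R]_(m, n)) :
  has_sup [set enorm (A *m v) | v in [set v : 'cV[R]_n | enorm v <= 1]].
Proof.
split; first by exists (enorm (A *m 0)); exists 0 => //=; rewrite enorm0.
have [c c0 Ac] := opnorm_ub A.
by exists c => _ [v /= v1 <-]; rewrite (le_trans (Ac v))// ler_piMr.
Qed.

Lemma opnorm_ge0 m n (A : 'M[R]_(m, n)) : 0 <= opnorm A.
Proof.
apply: (@le_trans _ _ (enorm (A *m 0))); first exact: enorm_ge0.
apply: sup_upper_bound; first exact: opnorm_has_sup.
by exists 0 => //=; rewrite enorm0.
Qed.

Lemma opnormP m n (A : 'M[R]_(m, n)) v : enorm (A *m v) <= opnorm A * enorm v.
Proof.
have [v0|v0] := eqVneq (enorm v) 0.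
  by rewrite (enorm_eq0 v0) mulmx0 !enorm0 mulr0.
have vp : 0 < enorm v by rewrite lt_def v0 enorm_ge0.
rewrite -ler_pdivrMr// mulrC -[leLHS](_ : enorm (A *m ((enorm v)^-1 *: v)) = _).
  apply: sup_upper_bound; first exact: opnorm_has_sup.
  exists ((enorm v)^-1 *: v) => //=.
  by rewrite enormZ ger0_norm ?invr_ge0 ?enorm_ge0// mulVf ?lexx.
by rewrite -scalemxAr enormZ ger0_norm// invr_ge0 enorm_ge0.
Qed.

Lemma opnorm_gt0 m n (A : 'M[R]_(m, n)) : A != 0 -> 0 < opnorm A.
Proof.
move=> A0; rewrite lt_def opnorm_ge0 andbT; apply: contra_neq A0 => A0.
apply/matrixP => i j; have := opnormP A (delta_mx j 0); rewrite A0 mul0r => H.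
have {}H : enorm (A *m delta_mx j (0 : 'I_1)) = 0 by apply/le_anti; rewrite H enorm_ge0.
by have := enorm_eq0 H; rewrite -colE => /matrixP /(_ i 0); rewrite !mxE.
Qed.

(** Divide |A^T v|^2 = <A A^T v, v> <= |A| |A^T v| |v| by |A^T v|. *)
Lemma opnorm_trmxP m n (A : 'M[R]_(m, n)) v : enorm (A^T *m v) <= opnorm A * enorm v.
Proof.
have [v0|v0] := eqVneq (enorm (A^T *m v)) 0.
  by rewrite v0 mulr_ge0 ?opnorm_ge0 ?enorm_ge0.
have vp : 0 < enorm (A^T *m v) by rewrite lt_def v0 enorm_ge0.
rewrite -(ler_pM2r vp) -expr2 enorm_sqr dot_trmx.
rewrite (le_trans (cauchy_schwarz _ _))// mulrAC ler_wpM2r ?enorm_ge0//.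
exact: opnormP.
Qed.

End Euclidean.

(** * Quadratic bounds of smooth functions, and differentiability from such bounds *)

Lemma diff_of_quad_remainder {R : realType} (V W : normedModType R) (g : V -> W)
    (df : {linear V -> W}) x (C : R) : continuous df -> 0 <= C ->
  (forall h, `|g (h + x) - g x - df h| <= C * `|h| * `|h|) ->
  differentiable g x /\ 'd g x = df :> (V -> W).
Proof.
move=> cdf C0 bnd.
have E : g \o shift x = cst (g x) + df +o_ 0 id.
  apply/eqaddoP => _/posnumP[e]; near=> h.
  rewrite /= -[_ h]/(g (h + x) - (g x + df h)) opprD addrA.
  apply: le_trans (bnd h) _; rewrite ler_wpM2r//.
  apply: (@le_trans _ _ ((C + 1) * `|h|)); first by rewrite ler_wpM2r// lerDl.
  rewrite mulrC -ler_pdivlMr ?ltr_wpDl//.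
  near: h; apply/nbhs_norm0P; exists (e%:num / (C + 1)) => /=.
    by rewrite divr_gt0// ltr_wpDl.
  by move=> h /= /ltW.
have Ed := diff_unique cdf E; split=> //.
by apply/diff_locallyP; split; rewrite Ed.
Unshelve. all: by end_near. Qed.

Section QuadraticBounds.
Context {R : realType} {n : nat}.
Implicit Types (f g : 'cV[R]_n -> R) (G : 'cV[R]_n -> 'cV[R]_n) (D : set 'cV[R]_n).

(* [G] plays the role of a gradient of [g], with Hessian between [p] and [L]. *)
Definition quad_bounds (p L : R) g G : Prop := forall x y,
  p / 2 * dot (y - x) (y - x) <= g y - g x - dot (G x) (y - x)
    <= L / 2 * dot (y - x) (y - x).

Lemma dot_is_linear (u : 'cV[R]_n) : linear (dot u).
Proof. by move=> c x y; rewrite !dot_lin. Qed.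

(** A differential is a bundled linear map; [dot (G x)] is the candidate in [quad_bounds_diff]. *)
HB.instance Definition _ (u : 'cV[R]_n) :=
  GRing.isLinear.Build R 'cV[R]_n R _ (dot u) (dot_is_linear u).

Lemma dot_continuous (u : 'cV[R]_n) : continuous (dot u).
Proof.
apply: (@continuous_of_lip _ _ _ _ (enorm u * n%:R)) => x y.
rewrite -linearB/= (@le_trans _ _ (enorm u * enorm (x - y)))//.
  by rewrite ler_norml cauchy_schwarz dot_ge_enorm.
by rewrite -mulrA ler_wpM2l ?enorm_ge0// enorm_le_mx_norm.
Qed.

Lemma derive_grad f x v : differentiable f x -> 'D_v f x = dot (grad f x) v.
Proof.
move=> fx; rewrite deriveE// dotE [in LHS](matrix_sum_delta v) linear_sum.
apply: eq_bigr => i _; rewrite big_ord1 linearZ/= mulrC mxE.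
by rewrite deriveE.
Qed.

Lemma is_derive_line f x v t : differentiable f (x + t *: v) ->
  is_derive t 1 (fun s : R => f (x + s *: v)) (dot (grad f (x + t *: v)) v).
Proof.
move=> fx; rewrite -derive_grad//.
have E : (fun h : R => h^-1 *: (((fun s : R => f (x + s *: v)) \o shift t) (h *: 1) -
     f (x + t *: v))) =
     (fun h => h^-1 *: ((f \o shift (x + t *: v)) (h *: v) - f (x + t *: v))).
  apply/funext => h; congr (_ *: (f _ - _)) => /=.
  by rewrite scalerDl addrCA [h *: 1]mulr1.
by split; [rewrite /derivable E; exact: diff_derivable|rewrite /derive E].
Qed.

Lemma is_derive_quad (a b t : R) :
  is_derive t 1 (fun s : R => a * s + b * (s * s)) (a + 2 * t * b).
Proof.
have H0 := is_derive_id t (1 : R).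
have H1 := is_deriveZ a H0.
have H2 := is_deriveZ b (is_deriveM H0 H0).
have := is_deriveD H1 H2.
have -> : a *: 1 + b *: (id t *: 1 + id t *: 1) = a + 2 * t * b.
  by rewrite /GRing.scale/=; ring.
exact.
Qed.

(** Along the segment, f minus the quadratic a s + b s^2 has nonpositive derivative on (0, 1), so
    the mean value theorem replaces integration of the gradient. The hypothesis is one-sided so that
    it can be checked for f and for -f. *)
Lemma descent_upper (Lf : R) f (x y : 'cV[R]_n) :
  (forall z, differentiable f z) ->
  (forall z, dot (grad f z - grad f x) (y - x) <= Lf * enorm (z - x) * enorm (y - x)) ->
  f y - f x - dot (grad f x) (y - x) <= Lf / 2 * dot (y - x) (y - x).
Proof.
move=> df Hg; set v := y - x.
pose a := dot (grad f x) v; pose b := Lf / 2 * dot v v.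
pose phi : R -> R := (fun s => f (x + s *: v)) - (fun s => a * s + b * (s * s)).
have phiE t : phi t = f (x + t *: v) - (a * t + b * (t * t)) by [].
have dphi (t : R) : is_derive t 1 phi (dot (grad f (x + t *: v)) v - (a + 2 * t * b)).
  have H1 := @is_derive_line f x v t (df _).
  exact: (is_deriveB H1 (is_derive_quad _ _ _)).
have [c] : exists2 c, c \in `]0, 1[%R & phi 1 - phi 0 =
    (dot (grad f (x + c *: v)) v - (a + 2 * c * b)) * (1 - 0).
  apply: (@MVT R phi (fun c => _)) => //.
  apply: continuous_subspaceT => t; apply: differentiable_continuous.
  by apply/derivable1_diffP; case: (dphi t).
rewrite in_itv/= => /andP[c0 c1].
have -> : phi 1 - phi 0 = f y - f x - (a + b).
  by rewrite !phiE scale1r scale0r addr0 /v addrCA subrr addr0; ring.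
have := Hg (x + c *: v); rewrite addrAC subrr add0r enormZ gtr0_norm// -/v dotDl dotNl.
have -> : Lf * (c * enorm v) * enorm v = 2 * c * b by rewrite /b -enorm_sqr; field.
rewrite -/a => H e; change (f y - f x - a <= b).
clearbody a b; move: (dot _ v) (f y) (f x) H e; clear => *; lra.
Qed.

Lemma grad_opp f x : (forall z, differentiable f z) -> grad (\- f) x = - grad f x.
Proof.
move=> df; apply/matrixP => i j; rewrite !mxE deriveN//.
exact: diff_derivable.
Qed.

Lemma smooth_quad_bounds (Lf : R) f : smooth Lf f -> quad_bounds (- Lf) Lf f (grad f).
Proof.
move=> [df lf] x y.
have H z : `|dot (grad f z - grad f x) (y - x)| <= Lf * enorm (z - x) * enorm (y - x).
  rewrite (@le_trans _ _ (enorm (grad f z - grad f x) * enorm (y - x)))//.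
    by rewrite ler_norml cauchy_schwarz dot_ge_enorm.
  by rewrite ler_wpM2r ?enorm_ge0// lf.
apply/andP; split; last first.
  by apply: descent_upper => // z; apply: le_trans (H z); exact: ler_norm.
(* The lower bound for f is the upper bound for -f. *)
have := @descent_upper Lf (\- f) x y; rewrite /= grad_opp// dotNl.
have dN z : differentiable (\- f) z by exact: differentiableN.
move=> /(_ dN) K.
suff {}/K : forall z, dot (grad (\- f) z - - grad f x) (y - x) <=
    Lf * enorm (z - x) * enorm (y - x) by lra.
move=> z; rewrite grad_opp// -opprD dotNl; apply: le_trans (H z).
by rewrite -normrN ler_norm.
Qed.

(** Squeezed between two quadratics, the first-order remainder is a little-o of the increment. This
    is how the Moreau envelope, defined as an infimum, gets its gradient. *)
Lemma quad_bounds_diff p L g G (x : 'cV[R]_n) : quad_bounds p L g G ->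
  differentiable g x /\ grad g x = G x.
Proof.
move=> gG.
(* Absolute values because p may be negative; n * n converts the squared Euclidean norm into the
   squared sup norm. *)
pose C := (`|p| + `|L|) / 2 * (n%:R * n%:R).
have C0 : 0 <= C by rewrite /C !mulr_ge0// addr_ge0.
have bnd h : `|g (h + x) - g x - dot (G x) h| <= C * `|h| * `|h|.
  have := gG x (h + x); rewrite addrK => /andP[lo up].
  have hh : dot h h <= (n%:R * n%:R) * (`|h| * `|h|).
    rewrite -enorm_sqr expr2 mulrACA.
    by apply: ler_pM; rewrite ?enorm_ge0// enorm_le_mx_norm.
  have pl : `|p| / 2 * dot h h + `|L| / 2 * dot h h <= C * `|h| * `|h|.
    have -> : C * `|h| * `|h| = (`|p| + `|L|) / 2 * (n%:R * n%:R * (`|h| * `|h|)).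
      by rewrite /C -!mulrA.
    by rewrite -!mulrDl ler_wpM2l// divr_ge0// addr_ge0.
  have hh0 := dot_ge0 h.
  rewrite ler_norml; apply/andP; split.
    apply: le_trans lo; rewrite lerNl; apply: le_trans pl.
    rewrite -mulNr -mulNr -[leLHS]addr0 lerD//; last by rewrite !mulr_ge0.
    by rewrite ler_wpM2r// ler_wpM2r// -normrN ler_norm.
  apply: le_trans up _; apply: le_trans pl.
  rewrite -[leLHS]add0r lerD//; first by rewrite !mulr_ge0.
  by rewrite ler_wpM2r// ler_wpM2r// ler_norm.
have [dg Ed] := @diff_of_quad_remainder R 'cV[R]_n R g (dot (G x)) x C
  (@dot_continuous (G x)) C0 bnd.
split=> //; apply/matrixP => i j; rewrite ord1 mxE deriveE// Ed /= dotE (bigD1 i)//= big1.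
  by rewrite mxE !eqxx mulr1 addr0.
by move=> k /negbTE ki; rewrite mxE ki mulr0.
Qed.

Lemma quad_bounds_cont p L g G : quad_bounds p L g G -> continuous g.
Proof.
by move=> gG x; apply: differentiable_continuous; case: (quad_bounds_diff x gG).
Qed.

End QuadraticBounds.

(** * Minimization over closed and convex sets, and projections *)

Section Minimization.
Context {R : realType} {n : nat}.
Implicit Types (g : 'cV[R]_n -> R) (G : 'cV[R]_n -> 'cV[R]_n) (D : set 'cV[R]_n).

Definition convex_set D : Prop := forall x y t,
  D x -> D y -> 0 <= t <= 1 -> D (x + t *: (y - x)).

(** Transposition carries minimization to row vectors, where [bounded_closed_compact] and
    [EVT_min_rV] are stated. *)
Lemma trmx_continuous : continuous (fun v : 'rV[R]_n => v^T).
Proof.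
apply: (@continuous_of_lip _ _ _ _ 1) => u v; rewrite mul1r -linearB.
rewrite [leLHS]/Num.norm/= mx_normrE; apply/bigmax_leP; split=> // -[i j] _ /=.
by rewrite mxE coord_le_mx_norm.
Qed.

(** With d = v - x0, g(v) <= g(x0) forces p/2 |d|^2 <= |G x0| |d|, so the sublevel set of x0 has
    radius at most 2 |G x0| / p and is compact. *)
Lemma minimizer_exists p L g G D : 0 < p -> quad_bounds p L g G ->
  closed D -> D !=set0 -> exists2 x, D x & forall u, D u -> g x <= g u.
Proof.
move=> p0 gG cD [x0 Dx0].
pose S : set 'rV[R]_n := [set v | D v^T /\ g v^T <= g x0].
have cS : closed S.
  apply: closedI; first by apply: preimage_closed => //; move=> x _; exact: trmx_continuous.
  apply: (@preimage_closed _ _ (fun v : 'rV[R]_n => g v^T) [set r | r <= g x0]).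
    move=> x _; apply: (@continuous_comp _ _ _ (fun v : 'rV[R]_n => v^T) g).
      exact: trmx_continuous.
    exact: (quad_bounds_cont gG).
  exact: closed_le.
have bS v : S v -> `|v| <= enorm x0 + 2 * enorm (G x0) / p.
  move=> [_ gv].
  have -> : `|v| = `|v^T|.
    apply/le_anti/andP; split; rewrite [leLHS]/Num.norm/= mx_normrE; apply/bigmax_leP;
      split=> // -[i j] _ /=; first by rewrite (_ : v i j = v^T j i) ?coord_le_mx_norm// mxE.
    by rewrite mxE coord_le_mx_norm.
  apply: le_trans (mx_norm_le_enorm _) _.
  rewrite -[v^T](subrK x0) addrC; apply: le_trans (enorm_triangle _ _) _.
  rewrite lerD2l; set d := v^T - x0.
  have := gG x0 v^T => /andP[+ _]; rewrite -/d => H.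
  have K := dot_ge_enorm (G x0) d.
  have {H K} H : p / 2 * enorm d ^+ 2 <= enorm (G x0) * enorm d by rewrite enorm_sqr; lra.
  have [->|d0] := eqVneq (enorm d) 0; first by rewrite divr_ge0 ?mulr_ge0 ?enorm_ge0 ?ltW.
  have dp : 0 < enorm d by rewrite lt_def d0 enorm_ge0.
  move: H; rewrite expr2 mulrA ler_pM2r// => H.
  by rewrite ler_pdivlMr//; lra.
have S0 : S !=set0 by exists x0^T; rewrite /S/= trmxK.
have kS : compact S.
  apply: bounded_closed_compact cS; exists (enorm x0 + 2 * enorm (G x0) / p).
  by split=> [|M /ltW ltM v Sv]; [exact: num_real|apply: le_trans ltM; exact: bS].
have ctg : {within S, continuous (fun v => g v^T)}.
  apply: continuous_subspaceT => x.
  apply: (@continuous_comp _ _ _ (fun v : 'rV[R]_n => v^T) g).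
    exact: trmx_continuous.
  exact: (quad_bounds_cont gG).
have [c] := EVT_min_rV S0 kS ctg.
rewrite inE => -[Dc gc] mc; exists c^T => // u Du.
have [gu|/ltW gu] := leP (g u) (g x0); last exact: le_trans gu.
by have := mc u^T; rewrite inE trmxK; apply; split; rewrite /= trmxK.
Qed.

Lemma argminP g D : (exists2 x, D x & forall u, D u -> g x <= g u) ->
  D (argmin D g) /\ forall u, D u -> g (argmin D g) <= g u.
Proof.
move=> [x Dx gx].
by apply: (@xgetPex _ 0 [set x | D x /\ forall u, D u -> g x <= g u]); exists x.
Qed.

Lemma minimizer_vi p L g G D x u : quad_bounds p L g G -> convex_set D ->
  D x -> (forall u, D u -> g x <= g u) -> D u -> 0 <= dot (G x) (u - x).
Proof.
move=> gG cD Dx mx Du; rewrite leNgt; apply/negP => c0.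
set c := dot _ _ in c0; set q := dot (u - x) (u - x).
have q0 : 0 <= q by exact: dot_ge0.
(* This step along the segment satisfies t |L| q = (1 - t) (-c), so the quadratic bound gives a
   change of at most (t c + t^2 c) / 2 < 0, contradicting minimality. The term -c > 0 in the
   denominator keeps t in (0, 1] for every L. *)
pose t := - c / (- c + `|L| * q).
have Lq : 0 <= `|L| * q by rewrite mulr_ge0.
have den : 0 < - c + `|L| * q by rewrite ltr_pwDl// oppr_gt0.
have t0 : 0 < t by rewrite divr_gt0// oppr_gt0.
have t1 : t <= 1 by rewrite ler_pdivrMr// mul1r lerDl.
have := mx _ (cD _ _ t Dx Du _); rewrite t1 (ltW t0) => /(_ isT) H.
have := gG x (x + t *: (u - x)).
rewrite addrAC subrr add0r !dotZr dotZl -/c -/q => /andP[_ up].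
have tq : t * (`|L| * q) = - c + t * c.
  have : t * (- c + `|L| * q) = - c by rewrite divfK// gt_eqF.
  by rewrite mulrDr mulrN => /eqP; rewrite addrC subr_eq => /eqP.
have Lt : L / 2 * (t * (t * q)) <= t / 2 * (- c + t * c).
  rewrite -tq -subr_ge0.
  have -> : t / 2 * (t * (`|L| * q)) - L / 2 * (t * (t * q)) =
    (`|L| - L) * (t * t * q / 2) by ring.
  apply: mulr_ge0; first by rewrite subr_ge0 ler_norm.
  by apply: divr_ge0 => //; apply: mulr_ge0 => //; apply: mulr_ge0; exact: ltW.
have tc : t * c < 0 by rewrite pmulr_rlt0.
have ttc : t / 2 * (t * c) < 0 by rewrite pmulr_rlt0// divr_gt0.
move: H up Lt tc ttc; rewrite mulrDr mulrN.
move: (g _) (g _) (L / 2 * _) (t / 2 * (t * c)) => ga gb e1 e2.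
have -> : t / 2 * c = (t * c) / 2 by ring.
by move: (t * c); clear => *; lra.
Qed.

(** The variational inequality removes the linear term from the lower quadratic bound at the
    minimizer. *)
Lemma minimizer_growth p L g G D x u : quad_bounds p L g G -> convex_set D ->
  D x -> (forall u, D u -> g x <= g u) -> D u ->
  g x + p / 2 * dot (u - x) (u - x) <= g u.
Proof.
move=> gG cD Dx mx Du; have := minimizer_vi gG cD Dx mx Du.
by have /andP[+ _] := gG x u; move: (dot _ _) (dot _ _) => *; lra.
Qed.

(** The squared distance equals its second-order expansion, whence [quad_bounds 2 2]; its
    variational inequality is the obtuse-angle property of the projection. *)
Lemma projP D (v : 'cV[R]_n) : closed D -> convex_set D -> D !=set0 ->
  D (Defs.proj D v) /\ forall u, D u -> 0 <= dot (Defs.proj D v - v) (u - Defs.proj D v).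
Proof.
move=> clD cD D0.
pose g u : R := dot (u - v) (u - v); pose G u : 'cV[R]_n := 2 *: (u - v).
have gG : quad_bounds 2 2 g G.
  move=> x y; rewrite /g /G.
  have -> : y - v = (x - v) + (y - x) by rewrite [RHS]addrC addrA subrK.
  move: (x - v) (y - x) => a d; rewrite !dot_lin (dotC d a).
  by apply/andP; split; lra.
have [x Dx mx] := minimizer_exists (ltr0Sn R 1) gG clD D0.
have [Dp mp] : D (Defs.proj D v) /\ forall u, D u -> enorm (Defs.proj D v - v) <= enorm (u - v).
  by apply: argminP; exists x => // u Du; rewrite enorm_le mx.
split=> // u Du.
have := minimizer_vi gG cD Dp _ Du; rewrite /G dotZl pmulr_rge0//; apply.
by move=> w Dw; rewrite /g -enorm_le mp.
Qed.

(** Each projection is tested against the other in [projP]; the sum gives |a - c|^2 <= <u - v, a -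
    c>. *)
Lemma proj_lip D (u v : 'cV[R]_n) : closed D -> convex_set D -> D !=set0 ->
  enorm (Defs.proj D u - Defs.proj D v) <= enorm (u - v).
Proof.
move=> clD cD D0.
have [Du Hu] := projP u clD cD D0; have [Dv Hv] := projP v clD cD D0.
have := Hu _ Dv; have := Hv _ Du; set a := Defs.proj D u; set c := Defs.proj D v => H1 H2.
have [e0|e0] := eqVneq (enorm (a - c)) 0; first by rewrite e0 enorm_ge0.
have ep : 0 < enorm (a - c) by rewrite lt_def e0 enorm_ge0.
rewrite -(ler_pM2r ep) -expr2 enorm_sqr; apply: le_trans (cauchy_schwarz _ _).
have -> : u - v = (a - c) - (a - u) + (c - v).
  by rewrite !opprB; apply/matrixP => i j; rewrite !mxE; ring.
move: H1 H2; rewrite -(opprB a c) => H1 H2.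
move: (a - c) (a - u) (c - v) H1 H2 => d x y; rewrite !dot_lin => H1 H2; lra.
Qed.

End Minimization.

(** * The proximal Lagrangian, its minimizers and the Moreau envelope *)

Section Lagrangian.
Context {R : realType} {n m k : nat}.
Context (f : 'cV[R]_n -> R) (A : 'M[R]_(m, n)) (b : 'cV[R]_m).
Context (H : 'M[R]_(k, n)) (h : 'cV[R]_k) (Lf rho mu : R).
Context (feas : feasible A b H h !=set0) (smooth_f : smooth Lf f).
Context (rho_ge0 : 0 <= rho) (Lf_ge0 : 0 <= Lf) (Lf_mu : Lf < mu).

Local Notation X := (polyhedron H h).
Local Notation K := (proxlag f A b rho mu).
Local Notation xs := (xstar f A b H h rho mu).
Local Notation xb := (xbarstar f A b H h mu).
Local Notation Psi := (moreau f A b H h mu).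
Local Notation p := (mu - Lf).

Let p_gt0 : 0 < p. Proof. by rewrite subr_gt0. Qed.
Let mu_gt0 : 0 < mu. Proof. exact: le_lt_trans Lf_mu. Qed.

Definition gradlag x y z : 'cV[R]_n :=
  grad f x + A^T *m y + rho *: (A^T *m (A *m x - b)) + mu *: (x - z).

(** The remainder is exactly that of f, which lies within Lf/2 |d|^2 in absolute value, plus rho/2
    |A d|^2 plus mu/2 |d|^2. Hence K is strongly convex in x although f need not be convex. *)
Lemma proxlag_bounds y z : quad_bounds (mu - Lf) (Lf + rho * opnorm A ^+ 2 + mu)
  (fun x => K x y z) (fun x => gradlag x y z).
Proof.
move=> x x'; have /andP[] := smooth_quad_bounds smooth_f x x'.
have Ad := opnormP A (x' - x).
have {}Ad : dot (A *m (x' - x)) (A *m (x' - x)) <= opnorm A ^+ 2 * dot (x' - x) (x' - x).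
  rewrite -!enorm_sqr -exprMn lerXn2r ?nnegrE ?enorm_ge0//.
  by rewrite mulr_ge0 ?opnorm_ge0 ?enorm_ge0.
have rAd : rho / 2 * dot (A *m (x' - x)) (A *m (x' - x)) <=
    rho / 2 * (opnorm A ^+ 2 * dot (x' - x) (x' - x)).
  by rewrite ler_wpM2l// divr_ge0.
have rAd0 : 0 <= rho / 2 * dot (A *m (x' - x)) (A *m (x' - x)).
  by rewrite mulr_ge0 ?divr_ge0 ?dot_ge0.
have -> : K x' y z - K x y z - dot (gradlag x y z) (x' - x) =
  (f x' - f x - dot (grad f x) (x' - x)) +
  rho / 2 * dot (A *m (x' - x)) (A *m (x' - x)) + mu / 2 * dot (x' - x) (x' - x).
  rewrite /K /proxlag /auglag /gradlag !enorm_sqr.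
  have -> : A *m x' - b = (A *m x - b) + A *m (x' - x).
    by rewrite mulmxBr [RHS]addrC addrA subrK.
  have -> : x' - z = (x - z) + (x' - x) by rewrite [RHS]addrC addrA subrK.
  move: (x' - x) (x - z) (A *m x - b) (f x') (f x) (grad f x) => d e a f1 f0 G.
  rewrite !dotDl !dotZl !(dotC (A^T *m _)) !dot_trmx.
  move: (A *m d) => c; rewrite !dotDr (dotC c a) (dotC e d).
  by move: (dot G d) (dot a a) (dot a y) (dot a c) (dot c c) (dot c y) (dot d e)
    (dot d d) (dot e e) => *; field.
move: rAd rAd0; move: (dot (A *m _) _) (dot (x' - x) _) (f x' - f x - _) => *.
by apply/andP; split; lra.
Qed.

Lemma gradlag_lip x x' y z : enorm (gradlag x y z - gradlag x' y z) <=
  (Lf + rho * opnorm A ^+ 2 + mu) * enorm (x - x').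
Proof.
have -> : gradlag x y z - gradlag x' y z = (grad f x - grad f x') +
    (rho *: (A^T *m (A *m (x - x'))) + mu *: (x - x')).
  rewrite /gradlag mulmxBr !scalerBr !mulmxBr !scalerBr.
  by apply/matrixP => i j; rewrite !mxE; ring.
rewrite !mulrDl -[leRHS]addrA; apply: le_trans (enorm_triangle _ _) _.
apply: lerD; first by case: smooth_f => _; apply.
apply: le_trans (enorm_triangle _ _) _; rewrite !enormZ !ger0_norm ?(ltW mu_gt0)//.
rewrite lerD2r -mulrA ler_wpM2l// expr2 -mulrA.
apply: le_trans (opnorm_trmxP _ _) _.
by rewrite ler_wpM2l ?opnorm_ge0// opnormP.
Qed.

Lemma proxobj_bounds z : quad_bounds (mu - Lf) (Lf + mu) (proxobj f mu z)
  (fun x => grad f x + mu *: (x - z)).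
Proof.
move=> x x'; have /andP[] := smooth_quad_bounds smooth_f x x'.
rewrite /proxobj !enorm_sqr.
have -> : x' - z = (x - z) + (x' - x) by rewrite [RHS]addrC addrA subrK.
move: (x' - x) (x - z) (f x') (f x) (grad f x) => d e f1 f0 G.
rewrite !dotDl !dotZl !dotDr (dotC e d).
move: (dot G d) (dot d e) (dot d d) (dot e e) => *.
by apply/andP; split; lra.
Qed.

Lemma polyhedron_closed : closed X.
Proof.
have -> : X = \bigcap_i [set x : 'cV[R]_n | (H *m x) i 0 <= h i 0].
  by apply/seteqP; split => [x Xx i _|x Xx i]; [exact: Xx|exact: (Xx i Logic.I)].
apply: closed_bigI => i _.
apply: (@preimage_closed _ _ (fun x : 'cV[R]_n => (H *m x) i 0) [set r | r <= h i 0]).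
  move=> x _; have -> : (fun x : 'cV[R]_n => (H *m x) i 0) = dot (row i H)^T.
    by apply/funext => u; rewrite /dot trmxK -row_mul [RHS]mxE.
  exact: dot_continuous.
exact: closed_le.
Qed.

Lemma polyhedron_convex : convex_set X.
Proof.
move=> x x' t Xx Xx' /andP[t0 t1] i.
rewrite mulmxDr -scalemxAr mulmxBr.
have := Xx i; have := Xx' i; move: (H *m x) (H *m x') => v v'; rewrite !mxE.
move: (v i 0) (v' i 0) (h i 0) => u u' c H1 H2.
have : 0 <= t * (c - u') by rewrite mulr_ge0// subr_ge0.
have : 0 <= (1 - t) * (c - u) by rewrite mulr_ge0// subr_ge0.
move=> *; lra.
Qed.

Lemma polyhedron_nonempty : X !=set0.
Proof. by case: feas => x [Xx _]; exists x. Qed.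

Lemma feasible_closed : closed (feasible A b H h).
Proof.
apply: closedI; first exact: polyhedron_closed.
have -> : [set x | A *m x = b] = \bigcap_i [set x : 'cV[R]_n | (A *m x) i 0 = b i 0].
  apply/seteqP; split => [x /= Ax i _|x Ax]; first by rewrite /= Ax.
  by apply/matrixP => i j; rewrite ord1; exact: (Ax i Logic.I).
apply: closed_bigI => i _.
apply: (@preimage_closed _ _ (fun x : 'cV[R]_n => (A *m x) i 0) [set b i 0]).
  move=> x _; have -> : (fun x : 'cV[R]_n => (A *m x) i 0) = dot (row i A)^T.
    by apply/funext => u; rewrite /dot trmxK -row_mul [RHS]mxE.
  exact: dot_continuous.
exact: closed_eq.
Qed.

Lemma feasible_convex : convex_set (feasible A b H h).
Proof.
move=> x x' t [Xx Ax] [Xx' Ax'] t01; split; first exact: polyhedron_convex.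
by rewrite /= mulmxDr -scalemxAr mulmxBr Ax Ax' subrr scaler0 addr0.
Qed.

Lemma xstar_in y z : X (xs y z).
Proof.
by case: (argminP (minimizer_exists p_gt0 (proxlag_bounds y z) polyhedron_closed
  polyhedron_nonempty)).
Qed.

Lemma xstar_vi y z u : X u -> 0 <= dot (gradlag (xs y z) y z) (u - xs y z).
Proof.
have [Dx mx] := argminP (minimizer_exists p_gt0 (proxlag_bounds y z)
  polyhedron_closed polyhedron_nonempty).
exact: (minimizer_vi (proxlag_bounds y z) polyhedron_convex Dx mx).
Qed.

Lemma xstar_growth y z u : X u ->
  K (xs y z) y z + p / 2 * dot (u - xs y z) (u - xs y z) <= K u y z.
Proof.
have [Dx mx] := argminP (minimizer_exists p_gt0 (proxlag_bounds y z)
  polyhedron_closed polyhedron_nonempty).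
exact: (minimizer_growth (proxlag_bounds y z) polyhedron_convex Dx mx).
Qed.

Lemma xstar_min y z u : X u -> K (xs y z) y z <= K u y z.
Proof.
move=> Xu; apply: le_trans (xstar_growth y z Xu); rewrite lerDl.
by rewrite mulr_ge0 ?dot_ge0// divr_ge0// ltW.
Qed.

Lemma xbarstar_in z : feasible A b H h (xb z).
Proof.
by case: (argminP (minimizer_exists p_gt0 (proxobj_bounds z) feasible_closed feas)).
Qed.

Lemma xbarstar_growth z u : feasible A b H h u ->
  proxobj f mu z (xb z) + p / 2 * dot (u - xb z) (u - xb z) <= proxobj f mu z u.
Proof.
have [Dx mx] := argminP (minimizer_exists p_gt0 (proxobj_bounds z) feasible_closed feas).
exact: (minimizer_growth (proxobj_bounds z) feasible_convex Dx mx).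
Qed.

Lemma moreauE z : Psi z = proxobj f mu z (xb z).
Proof.
have mx u : feasible A b H h u -> proxobj f mu z (xb z) <= proxobj f mu z u.
  move=> Xu; apply: le_trans (xbarstar_growth z Xu); rewrite lerDl.
  by rewrite mulr_ge0 ?dot_ge0// divr_ge0// ltW.
have lb : lbound [set proxobj f mu z x | x in feasible A b H h] (proxobj f mu z (xb z)).
  by move=> _ [u Xu <-]; exact: mx.
have ix : [set proxobj f mu z x | x in feasible A b H h] (proxobj f mu z (xb z)).
  by exists (xb z) => //; exact: xbarstar_in.
apply/le_anti/andP; split; first by apply: ge_inf => //; exists (proxobj f mu z (xb z)).
by apply: lb_le_inf => //; exists (proxobj f mu z (xb z)).
Qed.

(** In a mixed difference every term depending on x alone or on (y, z) alone cancels; only the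
    couplings <A x, y> and -mu <x, z> survive. *)
Lemma proxlag_diff x x' y y' z z' :
  (K x' y z - K x' y' z') - (K x y z - K x y' z') =
  dot (A *m (x' - x)) (y - y') + mu * dot (x' - x) (z' - z).
Proof.
rewrite /proxlag /auglag !enorm_sqr.
have -> : A *m x' - b = (A *m x - b) + A *m (x' - x).
  by rewrite mulmxBr [RHS]addrC addrA subrK.
have -> : x' - z = (x - z) + (x' - x) by rewrite [RHS]addrC addrA subrK.
have -> : x' - z' = (x - z') + (x' - x) by rewrite [RHS]addrC addrA subrK.
have -> : z' - z = (x - z) - (x - z') by rewrite opprB [RHS]addrC addrA subrK.
move: (A *m (x' - x)) (A *m x - b) => e a.
move: (x - z) (x - z') (x' - x) (f x) (f x') => g g' d f0 f1.
move: (dot (a + e) (a + e)) (dot a a) => s1 s0.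
rewrite !(dotDl, dotDr, dotNr) (dotC g d) (dotC g' d).
by move: (dot d g) (dot d g') (dot d d) (dot g g) (dot g' g') (dot e y) (dot e y')
  (dot a y) (dot a y') => *; field.
Qed.

Lemma proxobj_diff x x' z z' :
  (proxobj f mu z x' - proxobj f mu z' x') - (proxobj f mu z x - proxobj f mu z' x) =
  mu * dot (x' - x) (z' - z).
Proof.
rewrite /proxobj !enorm_sqr.
have -> : x' - z = (x - z) + (x' - x) by rewrite [RHS]addrC addrA subrK.
have -> : x' - z' = (x - z') + (x' - x) by rewrite [RHS]addrC addrA subrK.
have -> : z' - z = (x - z) - (x - z') by rewrite opprB [RHS]addrC addrA subrK.
move: (x - z) (x - z') (x' - x) (f x) (f x') => g g' d f0 f1.
rewrite !(dotDl, dotDr, dotNr) (dotC g d) (dotC g' d).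
by move: (dot d g) (dot d g') (dot d d) (dot g g) (dot g' g') => *; field.
Qed.

(** Adding the quadratic growth at the two minimizers bounds p |a - c|^2 by the mixed difference of
    [proxlag_diff]. *)
Lemma xstar_lip y z y' z' : p * enorm (xs y z - xs y' z') <=
  opnorm A * enorm (y - y') + mu * enorm (z - z').
Proof.
have := xstar_growth y z (xstar_in y' z'); have := xstar_growth y' z' (xstar_in y z).
set a := xs y z; set c := xs y' z' => H1 H2.
have q : p * dot (a - c) (a - c) <= dot (A *m (a - c)) (y' - y) + mu * dot (a - c) (z - z').
  move: H1 H2 (proxlag_diff c a y' y z' z); rewrite -(opprB a c) dotNl dotNr opprK.
  move: (dot _ (y' - y)) (dot _ (z - z')) (dot (a - c) (a - c)).
  by move: (K a y z) (K c y z) (K a y' z') (K c y' z') => *; lra.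
have [e0|e0] := eqVneq (enorm (a - c)) 0.
  by rewrite e0 mulr0 addr_ge0// mulr_ge0 ?opnorm_ge0 ?enorm_ge0 ?(ltW mu_gt0).
have ep : 0 < enorm (a - c) by rewrite lt_def e0 enorm_ge0.
rewrite -(ler_pM2r ep) -mulrA -expr2 enorm_sqr; apply: le_trans q _.
rewrite mulrDl lerD//.
  apply: le_trans (cauchy_schwarz _ _) _; rewrite enormB mulrAC ler_wpM2r ?enorm_ge0//.
  exact: opnormP.
by rewrite -mulrA ler_wpM2l ?(ltW mu_gt0)// mulrC cauchy_schwarz.
Qed.

Lemma xbarstar_lip z z' : p * enorm (xb z - xb z') <= mu * enorm (z - z').
Proof.
have := xbarstar_growth z (xbarstar_in z'); have := xbarstar_growth z' (xbarstar_in z).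
set a := xb z; set c := xb z' => H1 H2.
have q : p * dot (a - c) (a - c) <= mu * dot (a - c) (z - z').
  move: H1 H2 (proxobj_diff c a z' z); rewrite -(opprB a c) dotNl dotNr opprK.
  move: (dot _ (z - z')) (dot (a - c) (a - c)).
  move: (proxobj f mu z a) (proxobj f mu z c) (proxobj f mu z' a) (proxobj f mu z' c).
  by move=> *; lra.
have [e0|e0] := eqVneq (enorm (a - c)) 0.
  by rewrite e0 mulr0 mulr_ge0 ?enorm_ge0 ?ltW.
have ep : 0 < enorm (a - c) by rewrite lt_def e0 enorm_ge0.
rewrite -(ler_pM2r ep) -mulrA -expr2 enorm_sqr; apply: le_trans q _.
by rewrite -mulrA ler_wpM2l ?(ltW mu_gt0)// mulrC cauchy_schwarz.
Qed.

(** Feasibility does not involve the center, so xbar*(z) competes in the problem at z'; the two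
    proximal terms differ by an exact quadratic. *)
Lemma moreau_upper z z' :
  Psi z' - Psi z - mu * dot (z - xb z) (z' - z) <= mu / 2 * dot (z' - z) (z' - z).
Proof.
have : Psi z' <= proxobj f mu z' (xb z).
  rewrite moreauE; apply: le_trans (xbarstar_growth z' (xbarstar_in z)); rewrite lerDl.
  by rewrite mulr_ge0 ?dot_ge0// divr_ge0// ltW.
rewrite (moreauE z) /proxobj !enorm_sqr.
have -> : xb z - z' = - ((z - xb z) + (z' - z)) by rewrite [z - _ + _]addrC addrA subrK opprB.
rewrite -(opprB z (xb z)); move: (z - xb z) (z' - z) (f _) (Psi _) => e d c P.
rewrite !dot_lin (dotC d e).
move=> *; lra.
Qed.

(** The lower bound is [moreau_upper] with z and z' exchanged, after replacing xbar*(z') by xbar*(z)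
    at Lipschitz cost mu / p. Its constant is negative, but any real constant gives
    differentiability. *)
Lemma moreau_bounds : quad_bounds (mu - 2 * (mu ^+ 2 / p)) mu Psi
  (fun z => mu *: (z - xb z)).
Proof.
move=> z z'; apply/andP; split; last by rewrite dotZl moreau_upper.
have := moreau_upper z' z; have := xbarstar_lip z' z.
have := cauchy_schwarz (xb z' - xb z) (z' - z).
rewrite dotZl; have -> : z - z' = - (z' - z) by rewrite opprB.
have -> : z' - xb z' = (z - xb z) + (z' - z) - (xb z' - xb z).
  by apply/matrixP => i j; rewrite !mxE; ring.
move: (xb z' - xb z) => e; move: (z' - z) (z - xb z) => d g.
rewrite !(dotDl, dotDr, dotNl, dotNr) -!enorm_sqr => H1 H2 H3.
have H4 : mu * (enorm e * enorm d) <= mu ^+ 2 / p * enorm d ^+ 2.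
  have -> : mu ^+ 2 / p * enorm d ^+ 2 = mu * (mu * enorm d / p * enorm d) by ring.
  by rewrite ler_wpM2l ?(ltW mu_gt0)// ler_wpM2r ?enorm_ge0// ler_pdivlMr// mulrC.
have : mu * dot e d <= mu * (enorm e * enorm d) by rewrite ler_wpM2l// (ltW mu_gt0).
move: H3 H4; move: (mu ^+ 2 / p) (enorm e * _) (dot e d) (dot g d) (enorm d ^+ 2).
by move: (Psi _) (Psi _) => P P' c ed a e' d2 *; lra.
Qed.

Lemma moreau_grad z : differentiable Psi z /\ grad Psi z = mu *: (z - xb z).
Proof. exact: (quad_bounds_diff z moreau_bounds). Qed.

(** Weak duality: on the feasible set the multiplier and penalty terms vanish. *)
Lemma dual_le_moreau y z : K (xs y z) y z <= Psi z.
Proof.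
have [Xx Ax] := xbarstar_in z; apply: le_trans (xstar_min y z Xx) _.
rewrite moreauE /K /proxlag /auglag /proxobj Ax subrr dot0l enorm0 expr0n/=.
by rewrite mulr0 !addr0.
Qed.

End Lagrangian.

(* [D], [r2], [E], [N] are the squares of |x - w|, |A w - b|, |x - z| and
   |z - xb z|, where w = xs y' z; [Wa] and [Vw] are the squared drifts of [xs]
   under the updates of y and z. *)
Lemma descent_scalar {R : realType} (mu sbar tau eta beta oA l q : R)
  (D r2 E N P0 Wa Vw U Q X1 X2 xx Ax2 Psi0 Psi1 d0 d1 g1 i1 i2 i3 : R) :
  2 <= mu -> 3 / 4 * mu <= q ->
  0 < tau -> tau * l ^+ 2 <= 1 / 6 -> tau * q <= 1 / 12 ->
  0 < eta -> eta * oA ^+ 2 <= tau / 200 ->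
  0 < beta -> beta <= tau / 100 -> beta <= 1 / 100 ->
  36 * mu * sbar ^+ 2 * beta <= eta ->
  0 <= D -> 0 <= r2 -> 0 <= E -> 0 <= Vw -> 0 <= Wa -> 0 <= xx ->
  d0 + eta * g1 + mu * beta * i1 + mu / 2 * beta ^+ 2 * E <= d1 ->
  Psi1 - Psi0 - mu * beta * i2 <= mu / 2 * beta ^+ 2 * E ->
  i2 = (xx - N - E) / 2 ->
  i2 - i1 <= i3 + 1 / 4 * E + sbar ^+ 2 * r2 ->
  i3 <= 1 / 10 * E + 5 / 2 * Vw ->
  xx <= 2 * D + 2 * (sbar ^+ 2 * r2) ->
  r2 / 2 - oA ^+ 2 * D / 2 <= g1 ->
  q ^+ 2 * Vw <= mu ^+ 2 * (beta ^+ 2 * E) ->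
  q ^+ 2 * Wa <= oA ^+ 2 * (eta ^+ 2 * Ax2) ->
  Ax2 <= 2 * r2 + 2 * (oA ^+ 2 * D) ->
  (1 - tau * q / 4) * D <= P0 + (tau * q / 4)^-1 * Wa ->
  X2 <= (1 + tau * q / 4) * X1 + (1 + (tau * q / 4)^-1) * Vw ->
  X1 <= Q ->
  U <= (1 - 2 * tau * q + tau ^+ 2 * l ^+ 2) * D ->
  2 * Psi1 - d1 + X2 <= 2 * Psi0 - d0 + P0 - mu * beta / 2 * N +
     (1 + tau * q / 4) * (Q - U).
Proof.
move=> mu2 q34 t0 tl tq e0 eA b0 bt b1 be D0 r0 E0 V0 W0 x0 hd hP hi2 hi3 hy hxx hg hV hW hA
  hP0 hX2 hX1 hU.
have q32 : 3 / 2 <= q by lra.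
have q0 : 0 < q by lra.
have mu0 : 0 < mu by lra.
(* s is the weight paid each time the reference minimizer moves, before and after the x step. The
   contraction rate, about 2 tau q, still leaves a multiple of tau q D which, with mu beta E / 2
   from Psi and eta r2 / 2 from the dual, absorbs all errors. *)
set s := tau * q / 4 in hP0 hX2 *.
have s0 : 0 < s by rewrite divr_gt0// mulr_gt0.
have s1 : s <= 1 / 48 by rewrite /s; lra.
have tD0 : 0 <= tau * D by rewrite mulr_ge0// ltW.
have tqD : 3 / 2 * (tau * D) <= tau * q * D.
  by rewrite mulrA ler_wpM2r// mulrC ler_pM2l.
pose B := mu * beta; have B0 : 0 < B by rewrite mulr_gt0.
have BE0 : 0 <= B * E by rewrite mulr_ge0// ltW.
have bE0 : 0 <= beta * E by rewrite mulr_ge0// ltW.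
(* 16/9 is the square of 4/3, the bound on mu / q. *)
have Vle : Vw <= 16 / 9 * (beta ^+ 2 * E).
  have : (3 / 4 * mu) ^+ 2 * Vw <= q ^+ 2 * Vw.
    by rewrite ler_wpM2r// lerXn2r// nnegrE; clear -mu0 q0 q34; lra.
  have m20 : 0 < mu ^+ 2 by rewrite exprn_gt0.
  move=> H; rewrite -(ler_pM2l m20); move: (le_trans H hV).
  by clear; move: (beta ^+ 2 * E) => *; lra.
have bb1 : beta ^+ 2 * E <= tau / 100 * (beta * E).
  by rewrite expr2 -mulrA ler_wpM2r.
have bb2 : beta ^+ 2 * E <= 1 / 100 * (beta * E).
  by rewrite expr2 -mulrA ler_wpM2r.
have mubE : 2 * (beta * E) <= B * E.
  by rewrite /B -mulrA ler_wpM2r.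
have sBE : 3 / 4 * (tau * (beta * E)) <= s * (B * E).
  have -> : s * (B * E) = tau * (q * mu / 4) * (beta * E) by rewrite /s /B; field.
  have -> : 3 / 4 * (tau * (beta * E)) = tau * (3 / 4) * (beta * E) by ring.
  rewrite ler_wpM2r// ler_pM2l//.
  have : 3 / 2 * 2 <= q * mu by apply: ler_pM => //; lra.
  lra.
(* Vw is of order beta^2 E and 1/s of order 1/(tau q): since beta <= tau / 100, one factor beta
   cancels 1/tau. *)
have sV : s^-1 * Vw <= 1 / 40 * (B * E).
  rewrite mulrC ler_pdivrMr//; move: Vle bb1 sBE.
  have -> : 1 / 40 * (B * E) * s = 1 / 40 * (s * (B * E)) by ring.
  have -> : tau / 100 * (beta * E) = 1 / 100 * (tau * (beta * E)) by field.
  have : 0 <= tau * (beta * E) by rewrite mulr_ge0// ltW.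
  by clear; move: (tau * (beta * E)) (s * (B * E)) (beta ^+ 2 * E) => *; lra.
have BV : B * Vw <= 1 / 1000 * (B * E).
  have : Vw <= 1 / 1000 * E.
    have : beta ^+ 2 * E <= (1 / 100) ^+ 2 * E.
      by rewrite ler_wpM2r// lerXn2r// nnegrE; clear -b0; lra.
    by move: Vle E0; clear; move: (beta ^+ 2 * E) => *; lra.
  move=> H; have : B * Vw <= B * (1 / 1000 * E) by rewrite ler_pM2l.
  by rewrite mulrCA.
have V1 : Vw <= 1 / 100 * (B * E).
  by move: Vle bb2 mubE bE0; clear; move: (beta ^+ 2 * E) (beta * E) (B * E) => *; lra.
(* The sign of [Ax2] is not among the hypotheses; when it is negative, [hW] forces q^2 Wa <= 0. *)
have eA2 : oA ^+ 2 * (eta ^+ 2 * Ax2) <= tau / 200 * (eta * Ax2) \/ Ax2 < 0.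
  have [A0|A0] := leP 0 Ax2; last by right.
  left; have -> : oA ^+ 2 * (eta ^+ 2 * Ax2) = eta * oA ^+ 2 * (eta * Ax2) by ring.
  by rewrite ler_wpM2r// mulr_ge0// ltW.
have eD : eta * (oA ^+ 2 * D) <= 1 / 200 * (tau * D).
  by rewrite mulrA [leRHS]mulrA ler_wpM2r//; clear -eA; lra.
have er0 : 0 <= eta * r2 by rewrite mulr_ge0// ltW.
have eD0 : 0 <= eta * (oA ^+ 2 * D).
  by apply: mulr_ge0; [exact: ltW|apply: mulr_ge0 => //; exact: sqr_ge0].
have eAx : eta * Ax2 <= 2 * (eta * r2) + 2 * (eta * (oA ^+ 2 * D)).
  have : eta * Ax2 <= eta * (2 * r2 + 2 * (oA ^+ 2 * D)) by rewrite ler_pM2l.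
  by rewrite mulrDr ![eta * (2 * _)]mulrCA.
(* For the drift in y it is eta |A|^2 <= tau / 200 that pays for 1/s. *)
have sW : s^-1 * Wa <= 1 / 50 * (eta * r2 + eta * (oA ^+ 2 * D)).
  rewrite mulrC ler_pdivrMr//.
  have W1 : 9 / 4 * Wa <= tau / 200 * (2 * (eta * r2) + 2 * (eta * (oA ^+ 2 * D))).
    apply: (@le_trans _ _ (q ^+ 2 * Wa)).
      rewrite ler_wpM2r// (_ : 9 / 4 = (3 / 2) ^+ 2); last by field.
      by rewrite lerXn2r// nnegrE; clear -q32; lra.
    apply: le_trans hW _; case: eA2 => [H|H].
      by apply: le_trans H _; rewrite ler_wpM2l//; clear -t0; lra.
    apply: (@le_trans _ _ 0).
      by rewrite mulr_ge0_le0 ?sqr_ge0// mulr_ge0_le0 ?sqr_ge0// ltW.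
    by rewrite mulr_ge0//; clear -t0 er0 eD0; lra.
  have : 3 / 8 * tau * (eta * r2 + eta * (oA ^+ 2 * D)) <= s * (eta * r2 + eta * (oA ^+ 2 * D)).
    rewrite ler_wpM2r ?addr_ge0// /s.
    have : tau * (3 / 2) <= tau * q by rewrite ler_pM2l.
    lra.
  have -> : 1 / 50 * (eta * r2 + eta * (oA ^+ 2 * D)) * s =
    1 / 50 * (s * (eta * r2 + eta * (oA ^+ 2 * D))) by ring.
  have : 0 <= tau * (eta * r2) by rewrite mulr_ge0// ltW.
  have : 0 <= tau * (eta * (oA ^+ 2 * D)) by rewrite mulr_ge0// ltW.
  move: W1; move: (s * _) => z.
  by clear; move: (eta * r2) (eta * (oA ^+ 2 * D)) => c c' *; lra.
(* tau^2 l^2 <= tau q / 9 leaves 17/9 = 2 - 1/9; multiplying by 1 + s = 1 + tau q / 4 leaves 59/36 =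
   17/9 - 1/4, and the negative cross term is dropped. *)
have fU : (1 + s) * U <= D - 59 / 36 * (tau * q * D).
  have t2 : tau ^+ 2 * l ^+ 2 <= 1 / 9 * (tau * q).
    have : tau * (tau * l ^+ 2) <= tau * (1 / 6) by rewrite ler_pM2l.
    have : tau * (3 / 2) <= tau * q by rewrite ler_pM2l.
    by rewrite mulrA -expr2; clear; move=> *; lra.
  have U1 : U <= (1 - 17 / 9 * (tau * q)) * D.
    by apply: le_trans hU _; rewrite ler_wpM2r//; clear -t2; lra.
  have U2 : (1 + s) * U <= (1 + s) * ((1 - 17 / 9 * (tau * q)) * D).
    by rewrite ler_pM2l// addr_gt0.
  apply: le_trans U2 _.
  have -> : (1 + s) * ((1 - 17 / 9 * (tau * q)) * D) =
      D - 59 / 36 * (tau * q * D) - 17 / 9 * (s * (tau * q * D)) by rewrite /s; field.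
  have : 0 <= s * (tau * q * D).
    by apply: mulr_ge0; [exact: ltW|apply: mulr_ge0 => //; apply: ltW; rewrite mulr_gt0].
  by clear; move: (tau * q * D) (s * (tau * q * D)) => *; lra.
have sD : (1 - s) * D = D - 1 / 4 * (tau * q * D) by rewrite /s; field.
have sX : (1 + s) * X1 <= (1 + s) * Q by rewrite ler_pM2l// addr_gt0.
have bE2 : mu / 2 * beta ^+ 2 * E <= 1 / 200 * (B * E).
  have : mu * (beta ^+ 2 * E) <= mu * (1 / 100 * (beta * E)) by rewrite ler_pM2l.
  by rewrite /B; clear; move=> *; lra.
have bE3 : 0 <= mu / 2 * beta ^+ 2 * E.
  by apply: mulr_ge0 => //; apply: mulr_ge0; [clear -mu0; lra|exact: sqr_ge0].
have fy : B * (i2 - i1) <= B * (i3 + 1 / 4 * E + sbar ^+ 2 * r2) by rewrite ler_pM2l.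
have fi3 : B * i3 <= B * (1 / 10 * E + 5 / 2 * Vw) by rewrite ler_pM2l.
have fx : B * xx <= B * (2 * D + 2 * (sbar ^+ 2 * r2)) by rewrite ler_pM2l.
have fg : eta * (r2 / 2 - oA ^+ 2 * D / 2) <= eta * g1 by rewrite ler_pM2l.
have fi2 : B * i2 = (B * xx - B * N - B * E) / 2 by rewrite hi2; field.
have BD : B * D <= 1 / 75 * (tau * q * D).
  have : B <= 1 / 75 * (tau * q).
    have : mu * beta <= (4 / 3 * q) * (tau / 100).
      by apply: ler_pM => //; clear -q34 mu0 q0 b0 t0 bt; lra.
    by rewrite /B; clear; move=> *; lra.
  by move=> H; have := ler_wpM2r D0 H; rewrite -!mulrA.
(* The error bound is paid for by the dual gain, through beta <= eta / (36 mu sbar^2). *)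
have Br : B * (sbar ^+ 2 * r2) <= 1 / 36 * (eta * r2).
  have : 36 * mu * sbar ^+ 2 * beta * r2 <= eta * r2 by rewrite ler_wpM2r.
  by rewrite /B; clear; move=> *; lra.
have hd1 : d0 + eta * g1 + B * i1 <= d1 by move: hd bE3; rewrite -/B; clear; move=> *; lra.
have hP1 : Psi1 - Psi0 - B * i2 <= 1 / 200 * (B * E) by apply: le_trans bE2.
have -> : mu * beta / 2 * N = B * N / 2 by rewrite /B; field.
rewrite sD in hP0.
have XV : X2 <= (1 + s) * Q + Vw + s^-1 * Vw by move: hX2 sX; rewrite mulrDl mul1r; clear; move=> *; lra.
rewrite mulrBr.
move: fy fi3 fx fg fi2 BD Br hd1 hP1 hP0 XV fU sV BV V1 sW eD eD0 er0 tqD tD0 BE0.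
rewrite !mulrBr !mulrDr.
have -> : B * (1 / 4 * E) = 1 / 4 * (B * E) by ring.
have -> : B * (1 / 10 * E) = 1 / 10 * (B * E) by ring.
have -> : B * (5 / 2 * Vw) = 5 / 2 * (B * Vw) by ring.
have -> : B * (2 * D) = 2 * (B * D) by ring.
have -> : B * (2 * (sbar ^+ 2 * r2)) = 2 * (B * (sbar ^+ 2 * r2)) by ring.
have -> : eta * (r2 / 2) = 1 / 2 * (eta * r2) by field.
have -> : eta * (oA ^+ 2 * D / 2) = 1 / 2 * (eta * (oA ^+ 2 * D)) by field.
clear.
move: (B * (sbar ^+ 2 * r2)) (eta * (oA ^+ 2 * D)) (tau * q * D) (tau * D) (eta * r2)
  (eta * g1) (s^-1 * Vw) (s^-1 * Wa) ((1 + s) * Q) ((1 + s) * U) (B * Vw) (B * E)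
  (B * D) (B * xx) (B * N) (B * i1) (B * i2) (B * i3) => *.
lra.
Qed.

(** * Descent of the potential in one iteration with an arbitrary gradient error *)

Section Descent.
Context {R : realType} {n m k : nat}.
Context (f : 'cV[R]_n -> R) (A : 'M[R]_(m, n)) (b : 'cV[R]_m).
Context (H : 'M[R]_(k, n)) (h : 'cV[R]_k) (Lf rho mu sbar : R).
Context (feas : feasible A b H h !=set0) (smooth_f : smooth Lf f).
Context (rho_ge0 : 0 <= rho) (Lf_ge0 : 0 <= Lf).
Context (mu_ge2 : 2 <= mu) (mu_ge4 : 4 * Lf <= mu).
Context (errb : error_bound f A b H h rho mu sbar).

Local Notation X := (polyhedron H h).
Local Notation K := (proxlag f A b rho mu).
Local Notation xs := (xstar f A b H h rho mu).
Local Notation xb := (xbarstar f A b H h mu).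
Local Notation Psi := (moreau f A b H h mu).
Local Notation gK := (gradlag f A b rho mu).
Local Notation p := (mu - Lf).
Local Notation lam := (Lf + rho * opnorm A ^+ 2 + mu).

Lemma Lf_lt_mu : Lf < mu.
Proof. by move: mu_ge2 mu_ge4 => *; lra. Qed.

Let Lf_mu := Lf_lt_mu.

Let p_ge : 3 / 4 * mu <= p. Proof. by move: mu_ge4 => *; lra. Qed.

(** Each parameter is changed in turn, with the minimizer of the later problem as competitor in the
    earlier one. K is affine in y and exactly quadratic in z, so no further error appears. *)
Lemma dual_ascent y z y' z' :
  K (xs y z) y z + dot (A *m xs y' z - b) (y' - y) +
    mu * dot (z - xs y' z') (z' - z) + mu / 2 * dot (z' - z) (z' - z)
  <= K (xs y' z') y' z'.
Proof.
have := xstar_min feas smooth_f rho_ge0 Lf_mu y z (xstar_in feas smooth_f rho_ge0 Lf_mu y' z).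
have := xstar_min feas smooth_f rho_ge0 Lf_mu y' z (xstar_in feas smooth_f rho_ge0 Lf_mu y' z').
have -> : K (xs y' z') y' z' = K (xs y' z') y' z +
    (mu * dot (z - xs y' z') (z' - z) + mu / 2 * dot (z' - z) (z' - z)).
  rewrite /proxlag !enorm_sqr.
  have -> : xs y' z' - z' = - ((z - xs y' z') + (z' - z)).
    by rewrite [_ + (z' - z)]addrC addrA subrK opprB.
  rewrite -(opprB z (xs y' z')).
  move: (z - xs y' z') (z' - z) (auglag _ _ _ _ _ _) => d e a.
  rewrite !(dotDl, dotDr, dotNl, dotNr) (dotC e d).
  by move: (dot d e) (dot d d) (dot e e) => *; field.
have -> : K (xs y' z) y' z = K (xs y' z) y z + dot (A *m xs y' z - b) (y' - y).
  rewrite /proxlag /auglag dotDr dotNr.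
  move: (dot _ y) (dot _ y') (f _) (_ * _) (_ * _) => *; ring.
move: (K _ _ _) (K _ _ _) (K _ _ _) (dot _ (y' - y)) (dot (z - _) _) (dot (z' - z) _) => *.
lra.
Qed.

Lemma gradlag_monotone x x' y z :
  p * dot (x - x') (x - x') <= dot (x - x') (gK x y z - gK x' y z).
Proof.
have /andP[+ _] := proxlag_bounds A b mu smooth_f rho_ge0 y z x x'.
have /andP[+ _] := proxlag_bounds A b mu smooth_f rho_ge0 y z x' x.
rewrite -(opprB x x') !dotNr dotNl opprK (dotC (x - x') (gK _ _ _ - _)).
move: (x - x') (gK x y z) (gK x' y z) (K _ _ _) (K _ _ _) => d g g' c c'.
by rewrite dotDl dotNl; move: (dot d d) (dot g d) (dot g' d) => *; lra.
Qed.

Lemma gradient_step_contracts x x' y z tau : 0 <= tau ->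
  let u := x - x' - tau *: (gK x y z - gK x' y z) in
  dot u u <= (1 - 2 * tau * p + tau ^+ 2 * lam ^+ 2) * dot (x - x') (x - x').
Proof.
move=> tau0; cbv zeta; have := gradlag_monotone x x' y z.
have := gradlag_lip A b smooth_f rho_ge0 Lf_ge0 Lf_mu x x' y z.
have mu_ge0 : 0 <= mu by exact: le_trans (ler0n _ 2) mu_ge2.
have lam0 := addr_ge0 (addr_ge0 Lf_ge0 (mulr_ge0 rho_ge0 (sqr_ge0 (opnorm A)))) mu_ge0.
rewrite -(@ler_pXn2r _ 2)// ?nnegrE ?enorm_ge0 ?mulr_ge0 ?enorm_ge0// exprMn !enorm_sqr.
move: (x - x') (gK x y z - gK x' y z) => d g; move: lam => l H1 H2.
rewrite !(dotDl, dotDr, dotNl, dotNr, dotZl, dotZr) (dotC g d).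
have : tau ^+ 2 * dot g g <= tau ^+ 2 * (l ^+ 2 * dot d d) by rewrite ler_wpM2l ?sqr_ge0.
have : tau * (p * dot d d) <= tau * dot d g by rewrite ler_wpM2l.
by move: (dot d d) (dot d g) (dot g g) => *; lra.
Qed.

(** w is a fixed point of the exact projected gradient step, so nonexpansiveness of the projection
    compares the noisy step with it. The proof adds the two variational inequalities directly. *)
Lemma projected_step_le x y z tau e : 0 < tau ->
  let w := xs y z in
  let u := x - w - tau *: (gK x y z - gK w y z) - tau *: e in
  let x' := Defs.proj X (x - tau *: (gK x y z + e)) in
  dot (x' - w) (x' - w) <= dot u u.
Proof.
move=> tau0; cbv zeta; set w := xs y z; set u := x - w - _ - _; set x' := Defs.proj _ _.
have Xw : X w by exact: xstar_in feas smooth_f rho_ge0 Lf_mu _ _.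
have [Xx' vi] := projP (x - tau *: (gK x y z + e)) (@polyhedron_closed _ _ _ H h)
  (@polyhedron_convex _ _ _ H h) (polyhedron_nonempty feas).
have := vi _ Xw; rewrite -/x'.
have := xstar_vi feas smooth_f rho_ge0 Lf_mu y z Xx'; rewrite -/w -/x' => H1 H2.
have {}H1 : 0 <= tau * dot (gK w y z) (x' - w) by rewrite mulr_ge0// ltW.
have ud : dot u (x' - w) = dot (x' - w) (x' - w) +
    (dot (x' - (x - tau *: (gK x y z + e))) (w - x') + tau * dot (gK w y z) (x' - w)).
  rewrite /u -(opprB x' w) dotNr -dotNl -dotZl -!dotDl; congr dot.
  move: (gK x y z) (gK w y z) => g g'.
  by apply/matrixP => i j; rewrite !mxE; ring.
have := @young _ _ u (x' - w) (1 / 2) ltac:(lra).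
have -> : (4 * (1 / 2 : R))^-1 = 1 / 2 by field.
rewrite ud; move: H1 H2.
move: (dot u u) (dot (x' - w) (x' - w)) (dot _ (w - x')) (tau * _) => *; lra.
Qed.

Definition potential x y z : R :=
  2 * Psi z - K (xs y z) y z + dot (x - xs y z) (x - xs y z).

Lemma moreau_le_potential x y z : Psi z <= potential x y z.
Proof.
have := dual_le_moreau feas smooth_f rho_ge0 Lf_mu y z; rewrite /potential.
have := dot_ge0 (x - xs y z); move: (K _ _ _) (Psi z) (dot _ _) => *; lra.
Qed.

(** Deterministic in e: u does not involve e, so the last term expands into a part linear in e and a
    multiple of |e|^2, whose expectations the oracle controls. *)
Lemma descent x y z tau eta beta e :
  0 < tau -> tau * lam ^+ 2 <= 1 / 6 -> tau * p <= 1 / 12 ->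
  0 < eta -> eta * opnorm A ^+ 2 <= tau / 200 ->
  0 < beta -> beta <= tau / 100 -> beta <= 1 / 100 ->
  36 * mu * sbar ^+ 2 * beta <= eta ->
  let y' := y + eta *: (A *m x - b) in
  let z' := z + beta *: (x - z) in
  let w := xs y' z in
  let u := x - w - tau *: (gK x y' z - gK w y' z) in
  potential (Defs.proj X (x - tau *: (gK x y' z + e))) y' z' <=
  potential x y z - mu * beta / 2 * dot (z - xb z) (z - xb z) +
  (1 + tau * p / 4) * (dot (u - tau *: e) (u - tau *: e) - dot u u).
Proof.
move=> tau0 tl tp eta0 etaA beta0 bt b1 be; cbv zeta.
set y' := y + _; set z' := z + _; set w := xs y' z; set u := x - w - _.
set x' := Defs.proj X _; set v := xs y' z'; set a := xs y z.
have zz : z' - z = beta *: (x - z) by rewrite /z' addrC addrA addNr add0r.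
have yy : y' - y = eta *: (A *m x - b) by rewrite /y' addrC addrA addNr add0r.
have mu_ge0 : 0 <= mu by exact: le_trans (ler0n _ 2) mu_ge2.
have p0 : 0 < p by move: p_ge mu_ge2 => *; lra.
have c0 : 0 < tau * p / 4 by rewrite divr_gt0// mulr_gt0.
have wb : dot (w - xb z) (w - xb z) <= sbar ^+ 2 * dot (A *m w - b) (A *m w - b).
  rewrite -!enorm_sqr -exprMn lerXn2r ?nnegrE ?enorm_ge0 ?(le_trans (enorm_ge0 _) (errb _ _))//.
  exact: errb.
have Aw : dot (A *m (x - w)) (A *m (x - w)) <= opnorm A ^+ 2 * dot (x - w) (x - w).
  rewrite -!enorm_sqr -exprMn lerXn2r ?nnegrE ?mulr_ge0 ?enorm_ge0 ?opnorm_ge0//.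
  exact: opnormP.
apply: (@descent_scalar R mu sbar tau eta beta (opnorm A) lam p
  (dot (x - w) (x - w)) (dot (A *m w - b) (A *m w - b)) (dot (x - z) (x - z))
  _ _ (dot (w - a) (w - a)) (dot (v - w) (v - w)) _ _ (dot (x' - w) (x' - w)) _
  (dot (x - xb z) (x - xb z)) (dot (A *m x - b) (A *m x - b)) _ _ _ _
  (dot (A *m w - b) (A *m x - b)) (dot (z - v) (x - z)) (dot (z - xb z) (x - z))
  (dot (v - w) (x - z))) => //; try exact: dot_ge0.
- have := dual_ascent y z y' z'; rewrite -/w -/v zz yy !dotZr dotZl.
  move: (K _ _ _) (K _ _ _) (dot (A *m w - b) _) (dot (z - v) _) (dot (x - z) _) => *.
  lra.
- have := moreau_upper feas smooth_f Lf_mu z z'; rewrite zz !dotZr dotZl.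
  move: (Psi _) (Psi _) (dot (z - xb z) _) (dot (x - z) _) => *; lra.
- have -> : x - xb z = (x - z) + (z - xb z) by rewrite addrA subrK.
  move: (x - z) (z - xb z) => d g; rewrite !(dotDl, dotDr) (dotC d g).
  by move: (dot g d) (dot d d) (dot g g) => *; field.
(* x*(y', z') is joined to xbar*(z) through w: the first leg is a drift, the second is controlled by
   the error bound. *)
- have -> : dot (z - xb z) (x - z) - dot (z - v) (x - z) =
      dot (v - w) (x - z) + dot (w - xb z) (x - z).
    rewrite -dotNl -!dotDl; congr dot.
    by apply/matrixP => i j; rewrite !mxE; ring.
  have := @young _ _ (x - z) (w - xb z) (1 / 4) ltac:(lra).
  have -> : (4 * (1 / 4 : R))^-1 = 1 by field.
  have := wb.
  rewrite (dotC (w - xb z) (x - z)).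
  move: (dot (v - w) _) (dot _ (w - xb z)) (dot _ (w - xb z)) (dot (x - z) (x - z)) (_ * dot _ _) => *.
  lra.
- rewrite dotC; have := @young _ _ (x - z) (v - w) (1 / 10) ltac:(lra).
  by have -> : (4 * (1 / 10 : R))^-1 = 5 / 2 by field.
- have -> : x - xb z = (x - w) + (w - xb z) by rewrite addrA subrK.
  have := @sqr_normD_le _ _ (x - w) (w - xb z) 1 ltr01; rewrite invr1.
  have := wb.
  move: (dot (x - w + _) _) (dot (x - w) _) (dot (w - _) _) (_ * dot _ _) => *; lra.
- have -> : A *m x - b = (A *m w - b) + A *m (x - w).
    by rewrite mulmxBr [RHS]addrC addrA subrK.
  have := Aw.
  move: (A *m w - b) (A *m (x - w)) (opnorm A ^+ 2 * _) => q d c.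
  have := @young _ _ (- q) d (1 / 2) ltac:(lra).
  have -> : (4 * (1 / 2 : R))^-1 = 1 / 2 by field.
  rewrite !dotNl !dotNr opprK dotDr.
  move: (dot q q) (dot q d) (dot d d) => *; lra.
- have := xstar_lip feas smooth_f rho_ge0 Lf_ge0 Lf_mu y' z' y' z.
  rewrite -/v -/w subrr enorm0 mulr0 add0r zz => H1.
  rewrite -!enorm_sqr -!exprMn lerXn2r ?nnegrE ?mulr_ge0 ?mulr_ge0 ?enorm_ge0 ?(ltW p0) ?(ltW beta0)//.
  by move: H1; rewrite enormZ gtr0_norm.
- have := xstar_lip feas smooth_f rho_ge0 Lf_ge0 Lf_mu y' z y z.
  rewrite -/w -/a subrr enorm0 mulr0 addr0 yy => H1.
  rewrite -!enorm_sqr -!exprMn lerXn2r ?nnegrE ?mulr_ge0 ?mulr_ge0 ?enorm_ge0 ?opnorm_ge0 ?(ltW p0) ?(ltW eta0)//.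
  by move: H1; rewrite enormZ gtr0_norm.
- have -> : A *m x - b = (A *m w - b) + A *m (x - w).
    by rewrite mulmxBr [RHS]addrC addrA subrK.
  have := @sqr_normD_le _ _ (A *m w - b) (A *m (x - w)) 1 ltr01; rewrite invr1.
  have := Aw.
  move: (dot (A *m w - b + _) _) (dot (A *m w - b) _) (dot (A *m (x - w)) _) (_ * dot _ _) => *.
  lra.
(* The weight c = s / (1 - s) is chosen so that 1 + c = 1 / (1 - s) and 1 + 1/c = 1 / s. *)
- have s1 : 0 < 1 - tau * p / 4 by lra.
  move: (tau * p / 4) c0 s1 => s c0 s1.
  have := @sqr_normD_le _ _ (x - a) (a - w) (s / (1 - s)) (divr_gt0 c0 s1).
  have -> : x - a + (a - w) = x - w by rewrite addrA subrK.
  have -> : 1 + s / (1 - s) = (1 - s)^-1 by field; apply: lt0r_neq0.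
  have -> : 1 + (s / (1 - s))^-1 = s^-1 by field; rewrite !lt0r_neq0.
  rewrite -(opprB w a) dotNl dotNr opprK -(ler_pM2l s1) mulrDr mulrA mulfV ?lt0r_neq0// mul1r.
  move=> /le_trans; apply; rewrite lerD2l ler_piMl//.
    by rewrite mulr_ge0 ?dot_ge0// invr_ge0 ltW.
  lra.
- have := @sqr_normD_le _ _ (x' - w) (w - v) _ c0.
  by rewrite addrA subrK -(opprB v w) dotNl dotNr opprK.
- exact: projected_step_le.
- exact: gradient_step_contracts (ltW tau0).
Qed.

End Descent.

(** * Measurability of random vectors *)

Notation borel R n := (g_sigma_algebraType (@open 'cV[R]_n)).

Section CoordMeasurable.
Context {R : realType} {d : measure_display} {T : measurableType d}.

(** The coordinate form is easy to check on formulas; [mcoord_borel] and [borel_mcoord] identify it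
    with Borel measurability, which continuous maps preserve. *)
Definition mcoord n (Y : T -> 'cV[R]_n) : Prop :=
  forall i, measurable_fun [set: T] (fun w => Y w i 0).

(* Open sets of 'cV[R]_n are countable unions of rational boxes. *)
Lemma mcoord_borel n (Y : T -> 'cV[R]_n) : mcoord Y ->
  measurable_fun [set: T] (Y : T -> borel R n).
Proof.
move=> mY; apply: (@measurability _ _ _ (borel R n) _ _ (@open 'cV[R]_n)) => //.
move=> _ [U oU <-]; rewrite setTI.
pose box (q : 'cV[rat]_n * rat) :=
  [set x : 'cV[R]_n | forall i, `|x i 0 - ratr (q.1 i 0)| < ratr q.2].
have -> : Y @^-1` U = \bigcup_q (if `[< box q `<=` U >] then Y @^-1` box q else set0).
  apply/seteqP; split => [w Uw|w [q _]]; last by case: asboolP => // qU; exact: qU.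
  have /nbhs_ballP[e /= e0 eU] : nbhs (Y w) U by exact: open_nbhs_nbhs.
  (* The rational center is within r of Y w, hence every point of the box is within 2 r < e. *)
  have [r] := @rat_in_itvoo R 0 (e / 2) ltac:(by rewrite divr_gt0).
  rewrite in_itv/= => /andP[r0 re].
  have Q i : exists q : rat, `|Y w i 0 - ratr q| < ratr r.
    have [|q] := @rat_in_itvoo R (Y w i 0 - ratr r) (Y w i 0 + ratr r).
      by rewrite ltrD2l gtrN.
    by rewrite in_itv/= => /andP[q1 q2]; exists q; rewrite ltr_norml; apply/andP; split; lra.
  exists (\col_i sval (cid (Q i)), r) => //.
  have bY : box (\col_i sval (cid (Q i)), r) (Y w).
    by move=> i; rewrite /= mxE; case: cid.
  case: asboolP => // -[] x xb; apply: eU; split => // i j; rewrite ord1.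
  have := xb i; have := bY i; rewrite -ball_normE/= /ball_/=; move: (ratr _) => q.
  rewrite distrC => H1 H2.
  have -> : Y w i 0 - x i 0 = - (q - Y w i 0) - (x i 0 - q) by ring.
  by apply: le_lt_trans (ler_normB _ _) _; rewrite normrN; lra.
apply: countable_bigcupT_measurable; first exact: countableP.
move=> q; case: asboolP => // _.
have -> : Y @^-1` box q = \bigcap_(i in [set: 'I_n])
    ((fun w => Y w i 0 - ratr (q.1 i 0)) @^-1` [set r | `|r| < ratr q.2]).
  by apply/seteqP; split => [w bw i _|w bw i]; [exact: bw|exact: bw].
apply: fin_bigcap_measurable => // i _; rewrite -[X in measurable X]setTI.
have mYi : measurable_fun [set: T] (fun w => Y w i 0 - ratr (q.1 i 0)).
  by apply: measurable_funB.
apply: mYi => //.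
have -> : [set r : R | `|r| < ratr q.2] = ball (0 : R) (ratr q.2).
  by apply/seteqP; split => r; rewrite -ball_normE/= sub0r normrN.
by apply: open_measurable; exact: ball_open.
Qed.

Lemma continuous_borel n (g : 'cV[R]_n -> R) : continuous g ->
  measurable_fun [set: borel R n] (g : borel R n -> R).
Proof.
move=> /continuousP cg; apply: (measurability _ (RGenOpens.measurableE R)).
move=> _ [_ [a [c ->] <-]]; rewrite setTI; apply: sub_sigma_algebra.
exact/cg/interval_open.
Qed.

Lemma mcoord_continuous_fun n (g : 'cV[R]_n -> R) (Y : T -> 'cV[R]_n) :
  continuous g -> mcoord Y -> measurable_fun [set: T] (fun w => g (Y w)).
Proof.
move=> cg mY.
exact: (@measurableT_comp _ _ _ _ (borel R n) _ _ _ _ (continuous_borel cg)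
  (mcoord_borel mY)).
Qed.

Lemma mcoord_continuous n l (g : 'cV[R]_n -> 'cV[R]_l) (Y : T -> 'cV[R]_n) :
  continuous g -> mcoord Y -> mcoord (fun w => g (Y w)).
Proof.
move=> cg mY i; apply: (@mcoord_continuous_fun n (fun x => g x i 0)) => // x.
apply: (@continuous_comp _ _ _ g (fun v : 'cV[R]_l => v i 0)); first exact: cg.
exact: coord_continuous.
Qed.

Lemma borel_mcoord n (Y : T -> 'cV[R]_n) :
  measurable_fun [set: T] (Y : T -> borel R n) -> mcoord Y.
Proof.
move=> mY i.
apply: (@measurableT_comp _ _ _ _ (borel R n) _ (fun v : borel R n => v i 0) _ _ _ mY).
apply: (@continuous_borel n (fun v => v i 0)); exact: coord_continuous.
Qed.

Lemma mcoord_cst n (v : 'cV[R]_n) : mcoord (fun=> v).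
Proof. by move=> i; exact: measurable_cst. Qed.

Lemma mcoordD n (Y Z : T -> 'cV[R]_n) : mcoord Y -> mcoord Z ->
  mcoord (fun w => Y w + Z w).
Proof.
move=> mY mZ i; under eq_fun do rewrite mxE.
exact: measurable_funD.
Qed.

Lemma mcoordZ n c (Y : T -> 'cV[R]_n) : mcoord Y -> mcoord (fun w => c *: Y w).
Proof.
move=> mY i; under eq_fun do rewrite mxE.
exact: measurable_funM.
Qed.

Lemma mcoordN n (Y : T -> 'cV[R]_n) : mcoord Y -> mcoord (fun w => - Y w).
Proof. by move=> mY; under eq_fun do rewrite -scaleN1r; exact: mcoordZ. Qed.

Lemma mcoordB n (Y Z : T -> 'cV[R]_n) : mcoord Y -> mcoord Z ->
  mcoord (fun w => Y w - Z w).
Proof. by move=> mY mZ; apply: mcoordD => //; exact: mcoordN. Qed.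

Lemma mcoordM l n (M : 'M[R]_(l, n)) (Y : T -> 'cV[R]_n) : mcoord Y ->
  mcoord (fun w => M *m Y w).
Proof.
move=> mY i; under eq_fun do rewrite mxE.
by apply: measurable_sum => j; exact: measurable_funM.
Qed.

Lemma measurable_dot n (Y Z : T -> 'cV[R]_n) : mcoord Y -> mcoord Z ->
  measurable_fun [set: T] (fun w => dot (Y w) (Z w)).
Proof.
move=> mY mZ; under eq_fun do rewrite dotE.
by apply: measurable_sum => j; exact: measurable_funM.
Qed.

Lemma measurable_enorm n (Y : T -> 'cV[R]_n) : mcoord Y ->
  measurable_fun [set: T] (fun w => enorm (Y w)).
Proof.
apply: mcoord_continuous_fun.
apply: (@continuous_of_lip _ _ _ _ n%:R) => u v.
rewrite ler_norml; apply/andP; split.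
  rewrite lerNl opprB lerBlDr -{1}(subrK u v).
  by apply: le_trans (enorm_triangle _ _) _; rewrite lerD2r enormB enorm_le_mx_norm.
rewrite lerBlDr -{1}(subrK v u).
by apply: le_trans (enorm_triangle _ _) _; rewrite lerD2r enorm_le_mx_norm.
Qed.

(** Stacking the two arguments in one column reduces the claim to a single continuous map. It is
    meant for x*(y, z). *)
Lemma mcoord_lip2 n1 n2 l (g : 'cV[R]_n1 -> 'cV[R]_n2 -> 'cV[R]_l)
    (Y : T -> 'cV[R]_n1) (Z : T -> 'cV[R]_n2) c : 0 <= c ->
  (forall u u' v v', enorm (g u v - g u' v') <= c * enorm (u - u') + c * enorm (v - v')) ->
  mcoord Y -> mcoord Z -> mcoord (fun w => g (Y w) (Z w)).
Proof.
move=> c0 gc mY mZ.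
have -> : (fun w => g (Y w) (Z w)) = (fun w =>
    (fun u => g (usubmx u) (dsubmx u)) (col_mx (Y w) (Z w))).
  by apply/funext => w; rewrite col_mxKu col_mxKd.
apply: (@mcoord_continuous _ _ (fun u => g (usubmx u) (dsubmx u))
  (fun w => col_mx (Y w) (Z w))); last first.
  move=> i; case: (split_ordP i) => j ->.
    by under eq_fun do rewrite col_mxEu; exact: mY.
  by under eq_fun do rewrite col_mxEd; exact: mZ.
apply: (@continuous_of_lip _ _ _ _ (c * n1%:R + c * n2%:R)) => u v.
apply: le_trans (mx_norm_le_enorm _) _; apply: le_trans (gc _ _ _ _) _.
rewrite mulrDl -!mulrA lerD// ler_wpM2l//.
  rewrite -linearB; apply: le_trans (enorm_le_mx_norm _) _; rewrite ler_wpM2l//.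
  rewrite [leLHS]/Num.norm/= mx_normrE; apply/bigmax_leP; split=> // -[i j] _ /=.
  by rewrite mxE coord_le_mx_norm.
rewrite -linearB; apply: le_trans (enorm_le_mx_norm _) _; rewrite ler_wpM2l//.
rewrite [leLHS]/Num.norm/= mx_normrE; apply/bigmax_leP; split=> // -[i j] _ /=.
by rewrite mxE coord_le_mx_norm.
Qed.

End CoordMeasurable.

(** * Independence of the fresh sample from the past, and the random index *)

Section Independence.
Context {R : realType}.

(** Uniqueness of the product measure identifies the law of the pair. It is used for a state with
    the next sample, and for a gradient norm with the random index. *)
Lemma integral_indep_pair {d dW dS} {Om : measurableType d} {W : measurableType dW}
    {S : measurableType dS} (P : probability Om R) (Xi : probability S R)
    (Y : Om -> W) (xi : Om -> S) (g : W * S -> \bar R) :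
  measurable_fun [set: Om] Y -> measurable_fun [set: Om] xi ->
  (forall B C, measurable B -> measurable C ->
    P (Y @^-1` B `&` xi @^-1` C) = (P (Y @^-1` B) * Xi C)%E) ->
  measurable_fun [set: W * S] g -> (forall z, (0 <= g z)%E) ->
  (\int[P]_w g (Y w, xi w) = \int[P]_w \int[Xi]_s g (Y w, s))%E.
Proof.
move=> mY mxi ind mg g0.
pose Yf : {mfun Om >-> W} := HB.pack Y (isMeasurableFun.Build _ _ _ _ _ mY).
have mp : measurable_fun [set: Om] (fun w => (Y w, xi w)) by exact: measurable_fun_pair.
pose pf : {mfun Om >-> (W * S)%type} := HB.pack (fun w => (Y w, xi w))
  (isMeasurableFun.Build _ _ _ _ _ mp).
pose m1 : probability W R := distribution P Yf.
pose m' : probability (W * S)%type R := distribution P pf.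
have E X : measurable X -> (m1 \x Xi)%E X = m' X.
  apply: product_measure_unique => B C mB mC.
  rewrite /m' /m1 /distribution /pushforward/= -ind//.
transitivity (\int[m']_z g z)%E.
  by rewrite /m' ge0_integral_distribution.
transitivity (\int[m1 \x Xi]_z g z)%E.
  by apply: eq_measure_integral => D mD _; first [exact: E|exact: esym (E _ mD)].
rewrite fubini_tonelli1// /m1 ge0_integral_distribution//.
- exact: measurable_fun_fubini_tonelli_F.
- by move=> y; apply: integral_ge0.
Qed.

(** As functions of E, both sides are finite measures: P restricted to an event and a multiple of P.
    They agree on cylinders, which are stable under intersection and generate the history. *)
Lemma iid_history_indep {d dS} {Om : measurableType d} {S : measurableType dS}
    (P : probability Om R) (T : nat) (xi : nat -> {RV P >-> S}) (Xi : probability S R) t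
    (E : set Om) (C : set S) :
  iid T xi Xi -> (t < T)%N -> sigma_samples t xi E -> measurable C ->
  P (E `&` xi t @^-1` C) = (P E * Xi C)%E.
Proof.
move=> [law ind] tT sE mC.
have mxi s B : measurable B -> measurable (xi s @^-1` B).
  by move=> mB; rewrite -[X in measurable X]setTI; exact: measurable_funP.
pose G : set (set Om) := [set D | exists2 B : nat -> set S,
  (forall i, measurable (B i)) & D = \bigcap_(s in `I_t) (xi s @^-1` B s)].
have GI : setI_closed G.
  move=> _ _ [B mB ->] [B' mB' ->]; exists (fun i => B i `&` B' i).
    by move=> i; exact: measurableI.
  by rewrite -bigcapI; apply: eq_bigcapr => i _; rewrite preimage_setI.
have mG : G `<=` @measurable _ Om.
  move=> _ [B mB ->]; apply: bigcap_measurableType => // s _; exact: mxi.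
have sG : sigma_samples t xi `<=` <<s G >>.
  apply: smallest_sub; first exact: smallest_sigma_algebra.
  move=> D [s /= st [B mB <-]]; rewrite setTI; apply: sub_sigma_algebra.
  exists (fun i => if i == s then B else setT); first by move=> i; case: eqP.
  apply/seteqP; split => [w Bw i _ /=|w /(_ s st)/=]; last by rewrite eqxx.
  by case: eqP => // ->.
pose xC := xi t @^-1` C.
have mxC : measurable xC by exact: mxi.
have XC0 : 0 <= fine (Xi C) by exact: fine_ge0.
pose m2 := mscale (NngNum XC0) P.
have m2E D : m2 D = (P D * Xi C)%E.
  by rewrite /m2 /mscale/= fineK ?fin_num_measure// muleC.
rewrite -m2E -[LHS]/(mrestr P mxC E).
apply: (@g_sigma_algebra_measure_unique _ R _ G mG (fun=> setT)) => //.
- move=> _; exists (fun=> setT) => //; apply/seteqP; split => //.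
- by apply/seteqP; split => // w _; exists 0%N.
- move=> _ [B mB ->]; apply: eq_trans (esym (m2E _)); rewrite /= /mrestr.
  (* One family B' serves both cylinders: over J it describes the past event, and over J with t
     added also the event on the fresh sample. *)
  pose ot := Ordinal tT; pose J := [set i : 'I_T | (i < t)%N]%SET.
  pose B' (i : 'I_T) := if (i < t)%N then B i else C.
  have mB' i : measurable (B' i) by rewrite /B'; case: ifP.
  have otJ : ot \notin J by rewrite inE ltnn.
  have capJ : \bigcap_(s in `I_t) (xi s @^-1` B s) =
      \bigcap_(i in [set` J]) (xi i @^-1` B' i).
    apply/seteqP; split => [w Bw i|w Bw s /= st].
      by rewrite /= inE /B' => it; rewrite it; exact: Bw.
    have := Bw (Ordinal (ltn_trans st tT)); rewrite /= inE /B' /= st; exact.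
  have capJ' : \bigcap_(s in `I_t) (xi s @^-1` B s) `&` xC =
      \bigcap_(i in [set` (ot |: J)%SET]) (xi i @^-1` B' i).
    rewrite capJ; apply/seteqP; split => [w [Bw Cw] i|w Bw].
      rewrite /= in_setU1 => /orP[/eqP ->|]; last exact: Bw.
      by rewrite /B' /= ltnn.
    split; first by move=> i /= iJ; apply: Bw; rewrite /= in_setU1 iJ orbT.
    by have := Bw ot; rewrite /= in_setU1 eqxx /B' /= ltnn; exact.
  rewrite capJ' ind// capJ ind// big_setU1//= muleC; congr (_ * _)%E.
  by rewrite /B' /= ltnn -(law _ tT _ mC).
- by move=> _; rewrite /= /mrestr setTI -ge0_fin_numE// fin_num_measure.
- exact: sG.
Qed.

Lemma sigma_samples_measurable {d dS} {Om : measurableType d} {S : measurableType dS}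
    (P : probability Om R) (T : nat) (xi : nat -> {RV P >-> S}) :
  sigma_samples T xi `<=` @measurable _ Om.
Proof.
apply: smallest_sub; first exact: sigma_algebra_measurable.
move=> _ [s _ [B mB <-]].
exact: measurable_funP.
Qed.

(** Split over the values of t*: each N t is independent of t*, so every value contributes with
    weight 1/T. The shift to t.+1 reflects the range 1, ..., T. *)
Lemma uniform_index_integral {d dS} {Om : measurableType d} {S : measurableType dS}
    (P : probability Om R) (T : nat) (xi : nat -> {RV P >-> S}) (tstar : {RV P >-> nat})
    (N : nat -> Om -> R) :
  uniform_index T tstar -> independent_of_samples T tstar xi ->
  (forall t w, 0 <= N t w) ->
  (forall t B, (t <= T)%N -> measurable B -> sigma_samples T xi (N t @^-1` B)) ->
  measurable_fun [set: Om] (fun w => N (tstar w) w) /\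
  (\int[P]_w (N (tstar w) w)%:E =
   \sum_(t < T) (T%:R^-1)%:E * \int[P]_w (N t.+1 w)%:E)%E.
Proof.
move=> [rng unif] ind N0 sN.
have mN t : (t <= T)%N -> measurable_fun [set: Om] (N t).
  by move=> tT _ B mB; rewrite setTI; apply: (@sigma_samples_measurable _ _ _ _ P T xi); exact: sN.
have mt t : measurable (tstar @^-1` [set t]).
  by rewrite -[X in measurable X]setTI; exact: measurable_funP.
pose I t := \1_(tstar @^-1` [set t]) : Om -> R.
have NE w : N (tstar w) w = \sum_(t < T) N t.+1 w * I t.+1 w.
  have /andP[t1 tT] := rng w.
  have pT : ((tstar w).-1 < T)%N by rewrite prednK.
  rewrite (bigD1 (Ordinal pT))//= prednK// big1 ?addr0 => [|t tw].
    by rewrite /I indicE mem_set// mulr1.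
  rewrite /I indicE memNset ?mulr0// => /= e.
  by move/eqP: tw; apply; apply: val_inj; rewrite /= e.
have mNI (t : 'I_T) : measurable_fun [set: Om] (fun w => N t.+1 w * I t.+1 w).
  by apply: measurable_funM; [exact: mN|exact: measurable_indic].
have NI0 t w : 0 <= N t w * I t w by rewrite mulr_ge0// /I indicE ler0n.
split; first by under eq_fun do rewrite NE; exact: measurable_sum.
under eq_integral do rewrite NE -sumEFin.
rewrite ge0_integral_sum//; last 2 first.
- by move=> t; exact/measurable_EFinP.
- by move=> t w _; rewrite lee_fin.
apply: eq_bigr => t _.
(* The absolute value makes g nonnegative on the whole product and changes nothing at N t >= 0. *)
pose g (z : R * nat) : \bar R := (`|z.1| * \1_[set t.+1] z.2)%:E.
transitivity (\int[P]_w g (N t.+1 w, tstar w))%E.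
  by apply: eq_integral => w _; rewrite /g/= ger0_norm.
rewrite (@integral_indep_pair _ _ _ _ _ _ P (distribution P tstar) (N t.+1) tstar g) => //.
- have N0' w : [set: Om] w -> (0 <= (N t.+1 w)%:E)%E by rewrite lee_fin.
  have mN' : measurable_fun [set: Om] (EFin \o N t.+1) by apply/measurable_EFinP; exact: mN.
  rewrite -(ge0_integralZl_EFin _ _ N0' mN') ?invr_ge0//.
  apply: eq_integral => w _; rewrite /g/=.
  under eq_integral do rewrite EFinM.
  have i0 (j : nat) : [set: nat] j -> (0 <= (\1_[set t.+1] j : R)%:E)%E.
    by rewrite lee_fin indicE ler0n.
  have mi : measurable_fun [set: nat] (fun j => (\1_[set t.+1] j : R)%:E).
    by apply/measurable_EFinP; exact: measurable_indic.
  rewrite (ge0_integralZl_EFin _ _ i0 mi)//.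
  rewrite integral_indic// setIT muleC ger0_norm//; congr (_ * _)%E.
  by apply: unif; rewrite /= ltn_ord.
- exact: mN.
- move=> B C mB mC; rewrite setIC ind; last exact: sN.
  by rewrite muleC.
- apply/measurable_EFinP; apply: measurable_funM.
    by apply: measurableT_comp => //; exact: measurable_fst.
  by apply: measurableT_comp; [exact: measurable_indic|exact: measurable_snd].
- by move=> z; rewrite lee_fin mulr_ge0// indicE ler0n.
Qed.

End Independence.

(** The linear term is centered. The quadratic one is integrable because its integral is bounded by
    the real number v, which permits splitting the integral. *)
Lemma noise_integral {R : realType} {d} {S : measurableType d} {n} (Xi : probability S R)
    (Z : S -> 'cV[R]_n) (g u : 'cV[R]_n) (v C a c : R) :
  (forall i, Xi.-integrable [set: S] (fun s => (Z s i 0)%:E)) ->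
  (forall i, 'E_Xi[fun s => (Z s i 0)%R] = (g i 0)%:E)%E ->
  ('E_Xi[fun s => (enorm (Z s - g) ^+ 2)%R] <= v%:E)%E -> 0 <= c ->
  (\int[Xi]_s (C + a * dot u (Z s - g) + c * dot (Z s - g) (Z s - g))%:E <=
    (C + c * v)%:E)%E.
Proof.
move=> iZ EZ; rewrite unlock => VZ c0.
have iD i : Xi.-integrable [set: S] (fun s => (Z s i 0 - g i 0)%:E).
  apply: (@integrableB _ _ _ Xi _ _ (fun s => (Z s i 0)%:E) (cst (g i 0)%:E)) => //.
  exact: finite_measure_integrable_cst.
have Ec (r : R) : (\int[Xi]_s r%:E = r%:E)%E.
  have := @integral_cst _ _ _ Xi _ measurableT r%:E; rewrite [in RHS]/= probability_setT mule1.
  exact.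
have ED i : (\int[Xi]_s (Z s i 0 - g i 0)%:E = 0)%E.
  have := @integralB_EFin _ _ _ Xi _ (fun s => Z s i 0) (cst (g i 0)) measurableT.
  rewrite /comp => -> //; last exact: finite_measure_integrable_cst.
  have := EZ i; rewrite unlock => ->; rewrite Ec.
  by rewrite subee.
pose L s := dot u (Z s - g).
have LE s : (L s)%:E = (\sum_(i < n) ((u i 0%R)%:E * (Z s i 0%R - g i 0%R)%:E))%E.
  rewrite /L dotE -sumEFin; apply: eq_bigr => i _; rewrite -EFinM; congr (_ * _)%:E.
  by rewrite !mxE.
have iuD i : Xi.-integrable [set: S] (fun s => ((u i 0%R)%:E * (Z s i 0%R - g i 0%R)%:E)%E).
  exact: integrableZl.
have iL : Xi.-integrable [set: S] (fun s => (L s)%:E).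
  under eq_fun do rewrite LE.
  exact: integrable_sum.
have EL : (\int[Xi]_s (L s)%:E = 0)%E.
  under eq_integral do rewrite LE.
  rewrite integral_sum// big1// => i _.
  by rewrite integralZl// ED mule0.
pose Q s := dot (Z s - g) (Z s - g).
have mQ : measurable_fun [set: S] Q.
  have mZ : mcoord (fun s => Z s - g).
    apply: mcoordB; last exact: mcoord_cst.
    by move=> i; apply/measurable_EFinP; exact: measurable_int (iZ i).
  exact: measurable_dot.
have VQ : (\int[Xi]_s (Q s)%:E <= v%:E)%E.
  by move: VZ; under eq_integral do rewrite enorm_sqr.
have Q0 s : 0 <= Q s by exact: dot_ge0.
have iQ : Xi.-integrable [set: S] (fun s => (Q s)%:E).
  apply/integrableP; split; first exact/measurable_EFinP.
  under eq_integral do rewrite gee0_abs ?lee_fin//.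
  by apply: le_lt_trans VQ _; rewrite ltry.
have iC : Xi.-integrable [set: S] (fun s => (C + a * L s)%:E).
  apply: (@integrableD _ _ _ Xi _ _ (cst C%:E) (fun s => (a * L s)%:E)) => //.
    exact: finite_measure_integrable_cst.
  exact: (integrableZl measurableT a iL).
have icQ : Xi.-integrable [set: S] (fun s => (c * Q s)%:E).
  exact: (integrableZl measurableT c iQ).
have := @integralD_EFin _ _ _ Xi _ measurableT (fun s => C + a * L s) (fun s => c * Q s).
rewrite /comp => -> //.
have := @integralD_EFin _ _ _ Xi _ measurableT (cst C) (fun s => a * L s).
rewrite /comp => -> //; last 2 first.
- exact: finite_measure_integrable_cst.
- exact: (integrableZl measurableT a iL).
rewrite Ec.
under [X in (_ + X + _ <= _)%E]eq_integral do rewrite EFinM.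
rewrite integralZl// EL mule0 adde0 EFinD leeD2l//.
under eq_integral do rewrite EFinM.
rewrite integralZl// EFinM; apply: lee_pmul; rewrite ?lee_fin//.
by apply: integral_ge0 => s _; rewrite lee_fin Q0.
Qed.

(** * Measurability of the iterates and one step in expectation from a fixed state *)

Section Algorithm.
Context {R : realType} {n m k : nat}.
Context (f : 'cV[R]_n -> R) (A : 'M[R]_(m, n)) (b : 'cV[R]_m).
Context (H : 'M[R]_(k, n)) (h : 'cV[R]_k) (Lf rho mu sbar sigma : R).
Context (feas : feasible A b H h !=set0) (smooth_f : smooth Lf f).
Context (rho_ge0 : 0 <= rho) (Lf_ge0 : 0 <= Lf).
Context (mu_ge2 : 2 <= mu) (mu_ge4 : 4 * Lf <= mu).
Context (errb : error_bound f A b H h rho mu sbar).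
Context {dS : measure_display} {S : measurableType dS} (Xi : probability S R).
Context (F : 'cV[R]_n -> S -> 'cV[R]_n) (oracle : stochastic_oracle f sigma Xi F).
Context (tau eta beta flow : R).
Context (flowP : forall x, feasible A b H h x -> flow <= f x).

Local Notation X := (polyhedron H h).
Local Notation K := (proxlag f A b rho mu).
Local Notation xst := (xstar f A b H h rho mu).
Local Notation xb := (xbarstar f A b H h mu).
Local Notation Psi := (moreau f A b H h mu).
Local Notation pot := (potential f A b H h rho mu).
Local Notation next := (step A b H h F rho mu tau eta beta).
Local Notation p := (mu - Lf).
Local Notation lam := (Lf + rho * opnorm A ^+ 2 + mu).

Let Lf_mu : Lf < mu. Proof. exact: Lf_lt_mu mu_ge2 mu_ge4. Qed.
Let p_gt0 : 0 < p. Proof. by rewrite subr_gt0. Qed.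
Let mu_ge0 : 0 <= mu. Proof. exact: le_trans (ler0n _ 2) mu_ge2. Qed.

Definition mcoord_state {d} {T : measurableType d} (st : T -> @state R n m) : Prop :=
  [/\ mcoord (fun w => xs (st w)), mcoord (fun w => ys (st w)) &
      mcoord (fun w => zs (st w))].

Lemma mcoord_next d (T : measurableType d) (st : T -> state) (xi : T -> S) :
  mcoord_state st -> measurable_fun [set: T] xi ->
  mcoord_state (fun w => next (st w) (xi w)).
Proof.
move=> [mx my mz] mxi.
have mA : mcoord (fun w => A *m xs (st w) - b).
  by apply: mcoordB; [exact: mcoordM|exact: mcoord_cst].
have my' : mcoord (fun w => ys (st w) + eta *: (A *m xs (st w) - b)).
  by apply: mcoordD => //; exact: mcoordZ.
have mF : mcoord (fun w => F (xs (st w)) (xi w)).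
  move=> i; case: oracle => mF _ _ _.
  apply: (@measurableT_comp _ _ _ _ _ _ _ _ (fun w => (xs (st w) : borel R n, xi w)) (mF i)).
  by apply: measurable_fun_pair => //; exact: mcoord_borel.
have mG : mcoord (fun w => xs (st w) - tau *: gradest A b F rho mu (xs (st w))
    (ys (st w) + eta *: (A *m xs (st w) - b)) (zs (st w)) (xi w)).
  apply: mcoordB => //; apply: mcoordZ; rewrite /gradest.
  apply: mcoordD; last by apply: mcoordZ; exact: mcoordB.
  apply: mcoordD; last by apply: mcoordZ; exact: mcoordM.
  by apply: mcoordD => //; exact: mcoordM.
have cP : continuous (Defs.proj X).
  apply: (@continuous_of_elip _ _ _ _ 1) => // u v; rewrite mul1r.
  by apply: proj_lip; [exact: polyhedron_closed|exact: polyhedron_convex|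
    exact: polyhedron_nonempty feas].
have nE w : next (st w) (xi w) = State
    (Defs.proj X (xs (st w) - tau *: gradest A b F rho mu (xs (st w))
      (ys (st w) + eta *: (A *m xs (st w) - b)) (zs (st w)) (xi w)))
    (ys (st w) + eta *: (A *m xs (st w) - b))
    (zs (st w) + beta *: (xs (st w) - zs (st w))) (queries (st w)).+1.
  by case: (st w).
split; under eq_fun do rewrite nE /=.
- exact: mcoord_continuous cP mG.
- exact: my'.
- by apply: mcoordD => //; apply: mcoordZ; exact: mcoordB.
Qed.

Lemma mcoord_run d (T : measurableType d) x0 y0 (xi : nat -> T -> S) t :
  (forall s, (s < t)%N -> measurable_fun [set: T] (xi s)) ->
  mcoord_state (fun w => run A b H h F rho mu tau eta beta x0 y0 (xi ^~ w) t).
Proof.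
elim: t => [|t IH] mxi; first by split; exact: mcoord_cst.
apply: mcoord_next; last exact: mxi.
by apply: IH => s st; apply: mxi; exact: leq_trans st _.
Qed.

(** A minimizer picked by choice need not be measurable in its parameters; its Lipschitz estimate
    makes it continuous. *)
Lemma mcoord_xbarstar d (T : measurableType d) (Z : T -> 'cV[R]_n) :
  mcoord Z -> mcoord (fun w => xb (Z w)).
Proof.
apply: mcoord_continuous; apply: (@continuous_of_elip _ _ _ _ (mu / p)) => [|u v].
  by rewrite divr_ge0// ltW.
rewrite mulrAC ler_pdivlMr// mulrC.
exact: xbarstar_lip feas smooth_f Lf_ge0 Lf_mu u v.
Qed.

Lemma measurable_potential d (T : measurableType d) (st : T -> state) :
  mcoord_state st ->
  measurable_fun [set: T] (fun w => pot (xs (st w)) (ys (st w)) (zs (st w))).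
Proof.
move=> [mx my mz].
have mxs : mcoord (fun w => xst (ys (st w)) (zs (st w))).
  apply: (@mcoord_lip2 _ _ _ _ _ _ xst _ _ ((opnorm A + mu) / p)) => //.
    by apply: divr_ge0; [rewrite addr_ge0 ?opnorm_ge0|exact: ltW].
  move=> y y' z z'; rewrite -mulrDr mulrAC ler_pdivlMr// mulrC.
  apply: le_trans (xstar_lip feas smooth_f rho_ge0 Lf_ge0 Lf_mu y z y' z') _.
  rewrite mulrDl lerD//.
    by apply: ler_wpM2l; [exact: opnorm_ge0|rewrite lerDl enorm_ge0].
  by apply: ler_wpM2l => //; rewrite lerDr enorm_ge0.
have cPsi : continuous Psi.
  move=> z; apply: differentiable_continuous.
  by case: (moreau_grad feas smooth_f Lf_ge0 Lf_mu z).
have cf : continuous f by move=> z; apply: differentiable_continuous; case: smooth_f.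
have mA : mcoord (fun w => A *m xst (ys (st w)) (zs (st w)) - b).
  by apply: mcoordB; [exact: mcoordM|exact: mcoord_cst].
rewrite /potential; apply: measurable_funD.
  apply: measurable_funB.
    by apply: measurable_funM => //; exact: mcoord_continuous_fun.
  rewrite /proxlag /auglag; apply: measurable_funD.
    apply: measurable_funD.
      apply: measurable_funD; first exact: mcoord_continuous_fun.
      exact: measurable_dot.
    by apply: measurable_funM => //; apply: measurable_funX; exact: measurable_enorm.
  apply: measurable_funM => //; apply: measurable_funX; apply: measurable_enorm.
  exact: mcoordB.
by apply: measurable_dot; exact: mcoordB.
Qed.

(** The quadratic term is kept to bound the residual at the last iterate in [residual_le_gap]. *)
Lemma flow_le_moreau z : flow + mu / 2 * dot (z - xb z) (z - xb z) <= Psi z.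
Proof.
rewrite (moreauE feas smooth_f Lf_mu) /proxobj enormB enorm_sqr lerD2r.
exact/flowP/(xbarstar_in feas smooth_f Lf_mu).
Qed.

Lemma flow_le_potential x y z : flow <= pot x y z.
Proof.
apply: le_trans (moreau_le_potential feas smooth_f rho_ge0 mu_ge2 mu_ge4 x y z).
apply: le_trans (flow_le_moreau z); rewrite lerDl.
by rewrite mulr_ge0 ?dot_ge0// divr_ge0.
Qed.

Lemma expected_descent (st : state) :
  0 < tau -> tau * lam ^+ 2 <= 1 / 6 -> tau * p <= 1 / 12 ->
  0 < eta -> eta * opnorm A ^+ 2 <= tau / 200 ->
  0 < beta -> beta <= tau / 100 -> beta <= 1 / 100 ->
  36 * mu * sbar ^+ 2 * beta <= eta ->
  (\int[Xi]_s (pot (xs (next st s)) (ys (next st s)) (zs (next st s)) - flow)%:E +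
     (mu * beta / 2 * dot (zs st - xb (zs st)) (zs st - xb (zs st)))%:E <=
   (pot (xs st) (ys st) (zs st) - flow)%:E + (2 * tau ^+ 2 * sigma ^+ 2)%:E)%E.
Proof.
move=> tau0 tl tp eta0 etaA beta0 bt b1 be.
case: st => x y z q /=.
set y' := y + _; set z' := z + _; set N := mu * beta / 2 * _.
pose w := xst y' z.
pose u := x - w - tau *: (gradlag f A b rho mu x y' z - gradlag f A b rho mu w y' z).
(* c <= 2 is the origin of the factor 2 in the noise term. *)
pose c := 1 + tau * p / 4.
have tp0 : 0 < tau * p by rewrite mulr_gt0.
have c1 : 0 <= c by rewrite /c; lra.
have c2 : c <= 2 by rewrite /c; lra.
pose g := grad f x.
have pw s : pot (Defs.proj X (x - tau *: gradest A b F rho mu x y' z s)) y' z' - flow <=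
    (pot x y z - flow - N) + (- (2 * c * tau)) * dot u (F x s - g) +
      (c * tau ^+ 2) * dot (F x s - g) (F x s - g).
  have -> : gradest A b F rho mu x y' z s = gradlag f A b rho mu x y' z + (F x s - g).
    rewrite /gradest /gradlag -/g; move: (A^T *m y') (rho *: _) (mu *: _) => e1 e2 e3.
    by apply/matrixP => i j; rewrite !mxE; ring.
  have := descent feas smooth_f rho_ge0 Lf_ge0 mu_ge2 mu_ge4 errb x y z (F x s - g) tau0 tl tp
    eta0 etaA beta0 bt b1 be.
  cbv zeta; rewrite -/y' -/z' -/w -/u -/c -/N.
  move: u (F x s - g) => v e; rewrite !(dotDl, dotDr, dotNl, dotNr, dotZl, dotZr) (dotC e v).
  move: (pot x y z) (pot _ y' z') N (dot v v) (dot v e) (dot e e) => *; lra.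
have [_ iF EF VF] := oracle.
have mF : mcoord (F x).
  by move=> i; apply/measurable_EFinP; exact: measurable_int (iF x i).
have mFg : mcoord (fun s => F x s - g) by apply: mcoordB => //; exact: mcoord_cst.
have mst : mcoord_state (fun s : S => next (State x y z q) s).
  apply: (@mcoord_next _ _ (fun=> State x y z q)); last exact: measurable_id.
  by split; exact: mcoord_cst.
have mpot := measurable_potential mst.
have ct0 : 0 <= c * tau ^+ 2 by rewrite mulr_ge0// sqr_ge0.
have noise := @noise_integral _ _ _ _ Xi (F x) g u _ (pot x y z - flow - N)
  (- (2 * c * tau)) _ (iF x) (EF x) (VF x) ct0.
apply: (@le_trans _ _ ((pot x y z - flow - N + c * tau ^+ 2 * sigma ^+ 2)%:E + N%:E)%E).
  rewrite leeD2r//; apply: le_trans noise; apply: ge0_le_integral => //.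
  - by move=> s _; rewrite lee_fin subr_ge0 flow_le_potential.
  - by apply/measurable_EFinP; apply: measurable_funB => //; exact: mpot.
  - apply/measurable_EFinP; apply: measurable_funD.
      apply: measurable_funD => //; apply: measurable_funM => //.
      by apply: measurable_dot => //; exact: mcoord_cst.
    by apply: measurable_funM => //; exact: measurable_dot.
  - by move=> s _; rewrite lee_fin.
rewrite -!EFinD lee_fin.
have : c * tau ^+ 2 * sigma ^+ 2 <= 2 * tau ^+ 2 * sigma ^+ 2.
  have ts0 : 0 <= tau ^+ 2 * sigma ^+ 2 by rewrite mulr_ge0 ?sqr_ge0.
  by have := ler_wpM2r ts0 c2; rewrite !mulrA.
clear pw noise.
move: (pot x y z) N (c * tau ^+ 2 * sigma ^+ 2) (2 * tau ^+ 2 * sigma ^+ 2) => *; lra.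
Qed.

End Algorithm.

(** * Summation along the random run and the expected gradient norm *)

Section Convergence.
Context {R : realType} {n m k : nat}.
Context (f : 'cV[R]_n -> R) (A : 'M[R]_(m, n)) (b : 'cV[R]_m).
Context (H : 'M[R]_(k, n)) (h : 'cV[R]_k) (Lf rho mu sbar sigma : R).
Context (feas : feasible A b H h !=set0) (smooth_f : smooth Lf f).
Context (rho_ge0 : 0 <= rho) (Lf_ge0 : 0 <= Lf).
Context (mu_ge2 : 2 <= mu) (mu_ge4 : 4 * Lf <= mu).
Context (errb : error_bound f A b H h rho mu sbar).
Context {dS : measure_display} {S : measurableType dS} (Xi : probability S R).
Context (F : 'cV[R]_n -> S -> 'cV[R]_n) (oracle : stochastic_oracle f sigma Xi F).
Context (tau eta beta flow : R).
Context (flowP : forall x, feasible A b H h x -> flow <= f x).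
Context (tau_gt0 : 0 < tau).
Context (tau_lam : tau * (Lf + rho * opnorm A ^+ 2 + mu) ^+ 2 <= 1 / 6).
Context (tau_p : tau * (mu - Lf) <= 1 / 12).
Context (eta_gt0 : 0 < eta) (eta_le : eta * opnorm A ^+ 2 <= tau / 200).
Context (beta_gt0 : 0 < beta) (beta_tau : beta <= tau / 100) (beta_1 : beta <= 1 / 100).
Context (beta_eta : 36 * mu * sbar ^+ 2 * beta <= eta).
Context {d : measure_display} {Om : measurableType d} (P : probability Om R).
Context (T : nat) (xi : nat -> {RV P >-> S}) (iid_xi : iid T xi Xi).
Context (x0 : 'cV[R]_n) (y0 : 'cV[R]_m).

Local Notation xb := (xbarstar f A b H h mu).
Local Notation Psi := (moreau f A b H h mu).
Local Notation pot := (potential f A b H h rho mu).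
Local Notation next := (step A b H h F rho mu tau eta beta).
Local Notation st t w := (run A b H h F rho mu tau eta beta x0 y0 (fun s => xi s w) t).
Local Notation history t := (g_sigma_algebraType
  (\bigcup_(s in `I_t) preimage_set_system setT (xi s) measurable)).
Local Notation triple := (borel R n * borel R m * borel R n)%type.

(** States become points of a product measurable space. The counter is reset to 0, which is
    harmless: the next iterates and the potential do not depend on it. *)
Definition unpack (z : triple) : @state R n m := State z.1.1 z.1.2 z.2 0.
Definition pack (s : @state R n m) : triple := (xs s, ys s, zs s).

(** The run is adapted: measurability of the run is applied to the same sample space with the
    sigma-algebra generated by the samples drawn so far. *)
Lemma history_mcoord t t' : (t <= t')%N ->
  @mcoord_state _ _ _ _ (history t') (fun w => st t w).
Proof.
move=> tt'; apply: (@mcoord_run _ _ _ _ f A b H h rho mu sigma feas _ _ Xi F oracle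
  tau eta beta _ (history t') x0 y0 (fun s w => xi s w)) => s st _ B mB.
rewrite setTI; apply: sub_sigma_algebra; exists s => /=; first exact: leq_trans tt'.
by exists B => //; rewrite setTI.
Qed.

Lemma measurable_pack {d'} {T' : measurableType d'} (s : T' -> @state R n m) :
  mcoord_state s -> measurable_fun [set: T'] (fun w => pack (s w)).
Proof.
move=> [mx my mz]; apply: measurable_fun_pair; last exact: mcoord_borel.
by apply: measurable_fun_pair; exact: mcoord_borel.
Qed.

Lemma mcoord_unpack {d'} {T' : measurableType d'} (z : T' -> triple) :
  measurable_fun [set: T'] z -> mcoord_state (fun w => unpack (z w)).
Proof.
move=> mz; split; apply: borel_mcoord => /=.
- by do 2 apply: (measurableT_comp measurable_fst).
- by apply: (measurableT_comp measurable_snd); exact: (measurableT_comp measurable_fst).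
- exact: (measurableT_comp measurable_snd).
Qed.

Lemma run_mcoord t : mcoord_state (fun w => st t w).
Proof.
apply: (@mcoord_run _ _ _ _ f A b H h rho mu sigma feas _ _ Xi F oracle
  tau eta beta _ Om x0 y0 (fun s w => xi s w)) => s _.
exact: measurable_funP.
Qed.

Lemma run_step_indep t B C : (t < T)%N -> measurable B -> measurable C ->
  P ((fun w => pack (st t w)) @^-1` B `&` xi t @^-1` C) =
  (P ((fun w => pack (st t w)) @^-1` B) * Xi C)%E.
Proof.
move=> tT mB mC; apply: (iid_history_indep iid_xi) => //.
have := measurable_pack (history_mcoord (leqnn t)).
by move=> /(_ measurableT _ mB); rewrite setTI.
Qed.

(** The conditional inequality is integrated over the state; since all integrands are nonnegative,
    each side merges into one integral and pointwise comparison suffices. *)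
Lemma expected_descent_run t : (t < T)%N ->
  (\int[P]_w (pot (xs (st t.+1 w)) (ys (st t.+1 w)) (zs (st t.+1 w)) - flow)%:E +
   \int[P]_w (mu * beta / 2 * dot (zs (st t w) - xb (zs (st t w)))
     (zs (st t w) - xb (zs (st t w))))%:E <=
   \int[P]_w (pot (xs (st t w)) (ys (st t w)) (zs (st t w)) - flow)%:E +
   (2 * tau ^+ 2 * sigma ^+ 2)%:E)%E.
Proof.
move=> tT.
pose g (z : triple * S) : \bar R :=
  (pot (xs (next (unpack z.1) z.2)) (ys (next (unpack z.1) z.2))
    (zs (next (unpack z.1) z.2)) - flow)%:E.
have gE s u : g (pack s, u) =
    (pot (xs (next s u)) (ys (next s u)) (zs (next s u)) - flow)%:E by case: s.
have fp x y z : flow <= pot x y z.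
  exact: (flow_le_potential feas smooth_f rho_ge0 mu_ge2 mu_ge4 flowP).
have g0 z : (0 <= g z)%E by rewrite lee_fin subr_ge0.
have mg : measurable_fun [set: triple * S] g.
  apply/measurable_EFinP; apply: measurable_funB => //.
  apply: (measurable_potential feas smooth_f rho_ge0 Lf_ge0 mu_ge2 mu_ge4).
  apply: (@mcoord_next _ _ _ _ f A b H h rho mu sigma feas _ _ Xi F oracle tau eta beta
    _ (triple * S)%type (fun z => unpack z.1) snd); last exact: measurable_snd.
  by apply: mcoord_unpack; exact: measurable_fst.
have mY : measurable_fun [set: Om] (fun w => pack (st t w)).
  exact: measurable_pack (run_mcoord t).
have E1 : (\int[P]_w (pot (xs (st t.+1 w)) (ys (st t.+1 w)) (zs (st t.+1 w)) - flow)%:E =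
    \int[P]_w \int[Xi]_s g (pack (st t w), s))%E.
  have ind B C (mB : measurable B) (mC : measurable C) := run_step_indep tT mB mC.
  rewrite -(integral_indep_pair mY (measurable_funP (xi t)) ind mg g0).
  apply: eq_integral => w _; rewrite gE.
  reflexivity.
have mN : measurable_fun [set: Om] (fun w => mu * beta / 2 *
    dot (zs (st t w) - xb (zs (st t w))) (zs (st t w) - xb (zs (st t w)))).
  have [_ _ mz] := run_mcoord t.
  have mzx : mcoord (fun w => zs (st t w) - xb (zs (st t w))).
    by apply: mcoordB => //; exact: (mcoord_xbarstar feas smooth_f Lf_ge0 mu_ge2 mu_ge4).
  by apply: measurable_funM => //; exact: measurable_dot.
have mI : measurable_fun [set: Om] (fun w => \int[Xi]_s g (pack (st t w), s))%E.
  apply: (@measurableT_comp _ _ _ _ _ _ (fun z => \int[Xi]_s g (z, s))%E _ _ _ mY).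
  exact: measurable_fun_fubini_tonelli_F.
have mpot : measurable_fun [set: Om]
    (fun w => pot (xs (st t w)) (ys (st t w)) (zs (st t w)) - flow).
  apply: measurable_funB => //.
  exact: (measurable_potential feas smooth_f rho_ge0 Lf_ge0 mu_ge2 mu_ge4 (run_mcoord t)).
have d0 : 0 <= 2 * tau ^+ 2 * sigma ^+ 2 by rewrite mulr_ge0 ?sqr_ge0// mulr_ge0 ?sqr_ge0.
have N0 w : 0 <= mu * beta / 2 * dot (zs (st t w) - xb (zs (st t w)))
    (zs (st t w) - xb (zs (st t w))).
  have mu_ge0 : 0 <= mu by exact: le_trans (ler0n _ 2) mu_ge2.
  apply: mulr_ge0; last exact: dot_ge0.
  by apply: divr_ge0 => //; apply: mulr_ge0 => //; exact: ltW.
have I0 w : [set: Om] w -> (0 <= \int[Xi]_s g (pack (st t w), s))%E.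
  by move=> _; apply: integral_ge0 => s _; exact: g0.
have N0' w : [set: Om] w -> (0 <= (mu * beta / 2 * dot (zs (st t w) - xb (zs (st t w)))
    (zs (st t w) - xb (zs (st t w))))%:E)%E by rewrite lee_fin.
have p0 w : [set: Om] w -> (0 <= (pot (xs (st t w)) (ys (st t w)) (zs (st t w)) - flow)%:E)%E.
  by rewrite lee_fin subr_ge0.
have d0' w : [set: Om] w -> (0 <= (2 * tau ^+ 2 * sigma ^+ 2)%:E)%E by rewrite lee_fin.
have mN' := (measurable_EFinP _ _).2 mN; have mpot' := (measurable_EFinP _ _).2 mpot.
have md : measurable_fun [set: Om] (fun=> (2 * tau ^+ 2 * sigma ^+ 2)%:E) by exact: measurable_cst.
have dE : (\int[P]_w (2 * tau ^+ 2 * sigma ^+ 2)%:E)%E = (2 * tau ^+ 2 * sigma ^+ 2)%:E.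
  have := @integral_cst _ _ _ P _ measurableT (2 * tau ^+ 2 * sigma ^+ 2)%:E.
  by rewrite [in RHS]/= probability_setT mule1.
rewrite [X in (X + _ <= _)%E]E1.
rewrite -(ge0_integralD _ measurableT I0 mI N0' mN').
rewrite -dE.
rewrite -(ge0_integralD _ measurableT p0 mpot' d0' md).
apply: ge0_le_integral => //.
- by move=> w _; rewrite adde_ge0// ?I0// N0'.
- exact: emeasurable_funD.
- exact: emeasurable_funD.
move=> w _.
have := expected_descent feas smooth_f rho_ge0 Lf_ge0 mu_ge2 mu_ge4 errb oracle flowP
  (unpack (pack (st t w))) tau_gt0 tau_lam tau_p eta_gt0 eta_le beta_gt0 beta_tau beta_1 beta_eta.
by [].
Qed.

Lemma integral_cst_prob (r : R) : (\int[P]_w r%:E = r%:E)%E.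
Proof.
have := @integral_cst _ _ _ P _ measurableT r%:E.
by rewrite [in RHS]/= probability_setT mule1.
Qed.

(** Possibly infinite a priori; [descent_sum] shows it finite for t <= T. *)
Definition gap t : \bar R :=
  (\int[P]_w (pot (xs (st t w)) (ys (st t w)) (zs (st t w)) - flow)%:E)%E.

Definition residual t : \bar R :=
  (\int[P]_w (mu * beta / 2 * dot (zs (st t w) - xb (zs (st t w)))
    (zs (st t w) - xb (zs (st t w))))%:E)%E.

Let mu_ge0 : 0 <= mu. Proof. exact: le_trans (ler0n _ 2) mu_ge2. Qed.

Let res_ge0 (z : 'cV[R]_n) : 0 <= mu * beta / 2 * dot (z - xb z) (z - xb z).
Proof.
apply: mulr_ge0; last exact: dot_ge0.
by apply: divr_ge0 => //; apply: mulr_ge0 => //; exact: ltW.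
Qed.

Lemma residual_ge0 t : (0 <= residual t)%E.
Proof. by apply: integral_ge0 => w _; rewrite lee_fin. Qed.

Lemma mcoord_zxb t : mcoord (fun w => zs (st t w) - xb (zs (st t w))).
Proof.
have [_ _ mz] := run_mcoord t.
by apply: mcoordB => //; exact: (mcoord_xbarstar feas smooth_f Lf_ge0 mu_ge2 mu_ge4).
Qed.

Lemma measurable_residual t : measurable_fun [set: Om]
  (fun w => (mu * beta / 2 * dot (zs (st t w) - xb (zs (st t w)))
    (zs (st t w) - xb (zs (st t w))))%:E).
Proof.
apply/measurable_EFinP; apply: measurable_funM => //.
by apply: measurable_dot; exact: mcoord_zxb.
Qed.

(** Psi exceeds the lower bound of f by at least mu/2 |z - xbar*(z)|^2, and beta <= 1. This handles
    t = T, which the telescoped sum over t < T does not reach. *)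
Lemma residual_le_gap t : (residual t <= gap t)%E.
Proof.
apply: ge0_le_integral => //.
- by move=> w _; rewrite lee_fin.
- exact: measurable_residual.
- apply/measurable_EFinP; apply: measurable_funB => //.
  exact: (measurable_potential feas smooth_f rho_ge0 Lf_ge0 mu_ge2 mu_ge4 (run_mcoord t)).
move=> w _; rewrite lee_fin; move: (st t w) => [x y z q] /=.
have := flow_le_moreau feas smooth_f mu_ge2 mu_ge4 flowP z.
have := moreau_le_potential feas smooth_f rho_ge0 mu_ge2 mu_ge4 x y z.
have : mu * beta / 2 * dot (z - xb z) (z - xb z) <= mu / 2 * dot (z - xb z) (z - xb z).
  apply: ler_wpM2r; first exact: dot_ge0.
  rewrite mulrAC ler_piMr ?divr_ge0//.
  by apply: le_trans beta_1 _; lra.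
move: (pot x y z) (Psi z) (_ * dot _ _) (_ * dot _ _) => *; lra.
Qed.

Lemma descent_sum t : (t <= T)%N ->
  (\sum_(s < t) residual s + gap t <=
    (pot x0 y0 x0 - flow + t%:R * (2 * tau ^+ 2 * sigma ^+ 2))%:E)%E.
Proof.
elim: t => [_|t IH tT].
  rewrite big_ord0 add0e mul0r addr0 /gap /= integral_cst_prob.
  exact: lexx.
rewrite big_ord_recr/= -addeA.
apply: (@le_trans _ _ (\sum_(s < t) residual s + (gap t + (2 * tau ^+ 2 * sigma ^+ 2)%:E))%E).
  by rewrite leeD2l// addeC; exact: expected_descent_run.
rewrite addeA; apply: (@le_trans _ _
  ((pot x0 y0 x0 - flow + t%:R * (2 * tau ^+ 2 * sigma ^+ 2))%:E +
    (2 * tau ^+ 2 * sigma ^+ 2)%:E)%E).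
  by apply: leeD2r; apply: IH; exact: ltnW.
rewrite -EFinD lee_fin; move: (2 * tau ^+ 2 * sigma ^+ 2) => e.
by rewrite -natr1 mulrDl mul1r addrA.
Qed.

Lemma residual_sum : (0 < T)%N ->
  (\sum_(s < T) residual s.+1 <=
    (pot x0 y0 x0 - flow + T%:R * (2 * tau ^+ 2 * sigma ^+ 2))%:E)%E.
Proof.
have := @descent_sum T (leqnn T).
move: (pot _ _ _ - _ + _) residual gap residual_ge0 residual_le_gap => M r e r0 re.
(* The residual at 0 is discarded and the residual at T is taken from the final gap. *)
case: T => // T' + _; apply: le_trans; rewrite [leLHS]big_ord_recr [in leRHS]big_ord_recl/=.
rewrite -addeA; apply: (@le_trans _ _ (\sum_(i < T') r i.+1 + e T'.+1)%E).
  by apply: leeD2l; exact: re.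
by apply: leeDr; exact: r0.
Qed.

Lemma expected_gradnorm (tstar : {RV P >-> nat}) (eps : R) : (0 < T)%N -> 0 < eps ->
  uniform_index T tstar -> independent_of_samples T tstar xi ->
  measurable_fun [set: Om] (fun w => enorm (grad Psi (zs (st (tstar w) w)))) /\
  (\int[P]_w (enorm (grad Psi (zs (st (tstar w) w))))%:E <=
   (eps / 2 + mu / (eps * beta) / T%:R *
     (pot x0 y0 x0 - flow + T%:R * (2 * tau ^+ 2 * sigma ^+ 2)))%:E)%E.
Proof.
move=> T0 eps0 unif ind.
have gE z : grad Psi z = mu *: (z - xb z).
  by case: (moreau_grad feas smooth_f Lf_ge0 (Lf_lt_mu mu_ge2 mu_ge4) z).
pose N t w := enorm (grad Psi (zs (st t w))).
have NE t : N t = (fun w => enorm (mu *: (zs (st t w) - xb (zs (st t w))))).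
  by apply/funext => w; rewrite /N gE.
have mN t : measurable_fun [set: Om] (N t).
  rewrite NE.
  by apply: measurable_enorm; apply: mcoordZ; exact: mcoord_zxb.
(* The iterate at t = T still uses only the samples 0, ..., T - 1, on which independence of t* is
   assumed. *)
have hN t B : (t <= T)%N -> measurable B -> sigma_samples T xi (N t @^-1` B).
  move=> tT mB.
  suff : measurable_fun [set: history T] (N t) by move=> /(_ measurableT _ mB); rewrite setTI.
  rewrite NE.
  have [_ _ mz] := history_mcoord tT.
  apply: measurable_enorm; apply: mcoordZ; apply: mcoordB => //.
  exact: (mcoord_xbarstar feas smooth_f Lf_ge0 mu_ge2 mu_ge4).
have [mg ->] := uniform_index_integral unif ind (fun t w => enorm_ge0 _) hN.
split; first exact: mg.
have T0' : 0 < T%:R :> R by rewrite ltr0n.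
have cpos : 0 <= mu / (eps * beta).
  by apply: divr_ge0 => //; apply: mulr_ge0; exact: ltW.
have Nle t : (\int[P]_w (N t w)%:E <= (eps / 2)%:E + (mu / (eps * beta))%:E * residual t)%E.
  rewrite -(integral_cst_prob (eps / 2)).
  have r0 w : [set: Om] w -> (0 <= (mu * beta / 2 * dot (zs (st t w) - xb (zs (st t w)))
      (zs (st t w) - xb (zs (st t w))))%:E)%E by rewrite lee_fin.
  have e0 w : [set: Om] w -> (0 <= (eps / 2)%:E)%E by rewrite lee_fin divr_ge0 ?(ltW eps0).
  have mr := measurable_residual t.
  have me : measurable_fun [set: Om] (fun=> (eps / 2)%:E) by exact: measurable_cst.
  rewrite /residual -(ge0_integralZl_EFin P measurableT r0 mr cpos).
  have cr0 w : [set: Om] w -> (0 <= (mu / (eps * beta))%:E * (mu * beta / 2 *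
      dot (zs (st t w) - xb (zs (st t w))) (zs (st t w) - xb (zs (st t w))))%:E)%E.
    by move=> _; rewrite mule_ge0// lee_fin.
  have mcr := measurable_funeM (mu / (eps * beta))%:E mr.
  rewrite -(ge0_integralD P measurableT e0 me cr0 mcr).
  apply: ge0_le_integral => //.
  - by move=> w _; rewrite lee_fin enorm_ge0.
  - by apply/measurable_EFinP; exact: mN.
  - exact: emeasurable_funD me mcr.
  move=> w _; rewrite -EFinM -EFinD lee_fin /N gE enormZ ger0_norm//.
  set v := zs _ - _; rewrite -enorm_sqr; move: (enorm v) => r.
  (* The weight on the residual is chosen to produce the square in Young's inequality for mu r, the
     gradient norm. *)
  have -> : mu / (eps * beta) * (mu * beta / 2 * r ^+ 2) = (mu * r) ^+ 2 / (2 * eps).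
    by field; rewrite !lt0r_neq0.
  rewrite -subr_ge0.
  have -> : eps / 2 + (mu * r) ^+ 2 / (2 * eps) - mu * r = (eps - mu * r) ^+ 2 / (2 * eps).
    by field; rewrite lt0r_neq0.
  by rewrite divr_ge0 ?sqr_ge0// mulr_ge0// ltW.
apply: (@le_trans _ _ (\sum_(t < T) (T%:R^-1)%:E *
    ((eps / 2)%:E + (mu / (eps * beta))%:E * residual t.+1))%E).
  by apply: lee_sum => t _; apply: lee_wpmul2l; [rewrite lee_fin invr_ge0|exact: Nle].
pose c := T%:R^-1 * (mu / (eps * beta)).
have c0 : 0 <= c by rewrite mulr_ge0// invr_ge0 ltW.
rewrite (eq_bigr (fun t : 'I_T => (T%:R^-1 * (eps / 2))%:E + c%:E * residual t.+1)%E); last first.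
  move=> t _; rewrite ge0_muleDr ?lee_fin ?divr_ge0 ?(ltW eps0)//; last first.
    by rewrite mule_ge0 ?residual_ge0// lee_fin.
  by rewrite muleA -!EFinM.
rewrite big_split/= sumEFin sumr_const card_ord.
have -> : (T%:R^-1 * (eps / 2)) *+ T = eps / 2.
  by rewrite -[LHS]mulr_natl mulrA mulfV ?lt0r_neq0// mul1r.
rewrite -ge0_sume_distrr; last by move=> t _; exact: residual_ge0.
rewrite (_ : mu / (eps * beta) / T%:R = c); last by rewrite /c mulrC.
rewrite [leRHS]EFinD; apply: leeD2l; rewrite [leRHS]EFinM.
by apply: lee_wpmul2l; [rewrite lee_fin|exact: residual_sum].
Qed.

End Convergence.

(** * Bounds on the prescribed step sizes *)

Section StepSizes.
Context {R : realType} {m n : nat} (A : 'M[R]_(m, n)) (Lf rho sbar : R).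
Context (A_neq0 : A != 0) (Lf_ge0 : 0 <= Lf) (rho_ge0 : 0 <= rho) (sbar_gt0 : 0 < sbar).

Local Notation mu := (mu_par Lf).
Local Notation lam := (lambda_par A Lf rho).
Local Notation tau := (tau_par A Lf rho).
Local Notation eta := (eta_par A Lf rho).
Local Notation beta := (beta_par A Lf rho sbar).
Local Notation oA := (opnorm A).

Lemma mu_par_ge2 : 2 <= mu. Proof. by rewrite le_max lexx. Qed.

Lemma mu_par_ge4 : 4 * Lf <= mu. Proof. by rewrite le_max lexx orbT. Qed.

Let oA_gt0 : 0 < oA. Proof. exact: opnorm_gt0. Qed.
Let mu_gt0 : 0 < mu. Proof. exact: lt_le_trans (ltr0Sn R 1) mu_par_ge2. Qed.

Let c_gt0 : 0 < 36 * mu * sbar ^+ 2.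
Proof. by apply: mulr_gt0; [exact: mulr_gt0|exact: exprn_gt0]. Qed.

Lemma lambda_par_ge2 : 2 <= lam.
Proof.
apply: le_trans mu_par_ge2 _; rewrite lerDr; apply: addr_ge0 => //.
by apply: mulr_ge0 => //; exact: sqr_ge0.
Qed.

Let lam_gt0 : 0 < lam. Proof. exact: lt_le_trans (ltr0Sn R 1) lambda_par_ge2. Qed.

Let sqrtT_ge1 T : (0 < T)%N -> 1 <= Num.sqrt (T%:R : R).
Proof. by move=> T0; rewrite -[leLHS]sqrtr1 ler_sqrt ?ler1n. Qed.

Lemma tau_par_gt0 T : (0 < T)%N -> 0 < tau T.
Proof.
move=> T0; rewrite invr_gt0 mulr_gt0 ?mulr_gt0 ?exprn_gt0//.
exact: lt_le_trans (sqrtT_ge1 T0).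
Qed.

Lemma tau_par_sqr T : (0 < T)%N -> tau T * Num.sqrt T%:R * lam ^+ 2 = 1 / 6.
Proof.
move=> T0; have s0 : 0 < Num.sqrt (T%:R : R) by exact: lt_le_trans (sqrtT_ge1 T0).
rewrite /tau_par; move: (Num.sqrt _) lam lam_gt0 s0 => s l l0 s0.
by field; rewrite !lt0r_neq0.
Qed.

Lemma tau_par_lambda T : (0 < T)%N -> tau T * lam ^+ 2 <= 1 / 6.
Proof.
move=> T0; rewrite -(tau_par_sqr T0) mulrAC ler_peMr ?sqrtT_ge1//.
by rewrite mulr_ge0 ?sqr_ge0// ltW// tau_par_gt0.
Qed.

(** lam dominates both 2 and mu - Lf, so 2 (mu - Lf) <= lam^2. *)
Lemma tau_par_p T : (0 < T)%N -> tau T * (mu - Lf) <= 1 / 12.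
Proof.
move=> T0; have t0 := tau_par_gt0 T0.
have : tau T * (mu - Lf) * 2 <= tau T * lam ^+ 2.
  rewrite -mulrA ler_pM2l// expr2; apply: ler_pM => //.
  - by rewrite subr_ge0; apply: le_trans mu_par_ge4; rewrite ler_peMl// ler1n.
  - rewrite /lambda_par; have : 0 <= rho * oA ^+ 2 by rewrite mulr_ge0// sqr_ge0.
    by move: (rho * _) (mu_par Lf) Lf_ge0 => *; lra.
  - exact: lambda_par_ge2.
have := tau_par_lambda T0; move: (tau T * lam ^+ 2) (tau T * _) => *; lra.
Qed.

Lemma eta_par_gt0 T : (0 < T)%N -> 0 < eta T.
Proof.
move=> T0; have t0 := tau_par_gt0 T0.
have n1 : 0 < 2 * mu + rho * oA.
  by apply: ltr_pwDl; [exact: mulr_gt0|apply: mulr_ge0 => //; exact: ltW].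
have n2 : 0 < 2 * mu + rho * oA ^+ 2.
  by apply: ltr_pwDl; [exact: mulr_gt0|apply: mulr_ge0 => //; exact: sqr_ge0].
have o2 : 0 < oA ^+ 2 by exact: exprn_gt0.
have o4 : 0 < oA ^+ 4 by exact: exprn_gt0.
rewrite /eta_par !lt_min; apply/and3P.
by split; apply: divr_gt0; rewrite ?mulr_gt0.
Qed.

Lemma eta_par_opnorm T : eta T * oA ^+ 2 <= tau T / 200.
Proof.
have : eta T <= tau T / (200 * oA ^+ 2) by rewrite /eta_par !ge_min lexx orbT.
rewrite ler_pdivlMr ?mulr_gt0 ?exprn_gt0// mulrCA.
by move: (tau T) (eta T * _) => *; lra.
Qed.

Lemma beta_par_gt0 T : (0 < T)%N -> 0 < beta T.
Proof.
move=> T0; have t0 := tau_par_gt0 T0; have e0 := eta_par_gt0 T0.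
rewrite /beta_par !lt_min; apply/and3P; split.
- by rewrite divr_gt0.
- by rewrite invr_gt0 mulr_gt0.
- exact: divr_gt0.
Qed.

Lemma beta_par_tau T : beta T <= tau T / 100.
Proof. by rewrite /beta_par !ge_min lexx. Qed.

Lemma beta_par_1 T : beta T <= 1 / 100.
Proof.
apply: (@le_trans _ _ (50 * lam)^-1); first by rewrite /beta_par !ge_min lexx orbT.
rewrite div1r lef_pV2 ?posrE ?mulr_gt0//.
by have := lambda_par_ge2; move: lam => *; lra.
Qed.

Lemma beta_par_eta T : 36 * mu * sbar ^+ 2 * beta T <= eta T.
Proof.
have : beta T <= eta T / (36 * mu * sbar ^+ 2) by rewrite /beta_par !ge_min lexx !orbT.
by rewrite ler_pdivlMr// mulrC.
Qed.

(** tau sqrt T = 1 / (6 lam^2) <= 1/24 does not grow with T, so the noise accumulated over the whole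
    run stays bounded. *)
Lemma tau_par_total T : (0 < T)%N -> forall v, 0 <= v ->
  T%:R * (2 * tau T ^+ 2 * v) <= v.
Proof.
move=> T0 v v0.
have sE : Num.sqrt (T%:R : R) ^+ 2 = T%:R by rewrite sqr_sqrtr.
have -> : T%:R * (2 * tau T ^+ 2 * v) = 2 * (tau T * Num.sqrt T%:R) ^+ 2 * v.
  by rewrite exprMn sE; move: (tau T) (T%:R) => *; ring.
have l4 : 4 <= lam ^+ 2.
  have -> : 4 = 2 ^+ 2 :> R by rewrite -natrX.
  by rewrite lerXn2r ?nnegrE// ?(ltW lam_gt0)// lambda_par_ge2.
have : tau T * Num.sqrt T%:R <= 1 / 24.
  have := tau_par_sqr T0; have : 0 <= tau T * Num.sqrt T%:R.
    by rewrite mulr_ge0 ?sqrtr_ge0// ltW// tau_par_gt0.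
  move: (tau T * _) (lam ^+ 2) l4 => x y y4 x0 xy.
  have : x * 4 <= x * y by rewrite ler_wpM2l.
  by rewrite xy => *; lra.
have : 0 <= tau T * Num.sqrt T%:R by rewrite mulr_ge0 ?sqrtr_ge0// ltW// tau_par_gt0.
move: (tau T * _) => x x0 x1; rewrite ler_piMl//.
have : x ^+ 2 <= (1 / 24) ^+ 2 by rewrite lerXn2r// nnegrE; lra.
by move: (x ^+ 2) => *; lra.
Qed.

(** Every term of the nested minima is either constant in T or exactly proportional to T^(-1/2), so
    passing from 1 to T divides the minimum by at most sqrt T. *)
Lemma beta_par_lower T : (0 < T)%N -> beta 1 <= beta T * Num.sqrt T%:R.
Proof.
move=> T0; have s1 := sqrtT_ge1 T0; set s := Num.sqrt _ in s1 *.
have s0 : 0 < s by exact: lt_le_trans s1.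
have tE : tau T = tau 1 / s by rewrite /tau_par sqrtr1 mulr1 -invfM.
have mono x : 0 <= x -> x / s <= x by move=> x0; rewrite ler_pdivrMr// ler_peMr.
have eE : eta 1 / s <= eta T.
  rewrite /eta_par tE !le_min; apply/and3P; split.
  - apply: (@le_trans _ _ ((2 * mu + rho * oA) / (4 * oA ^+ 4) / s)).
      by rewrite ler_pM2r ?invr_gt0// ge_min lexx.
    apply: mono; apply: divr_ge0; last by rewrite mulr_ge0// exprn_ge0// ltW.
    by rewrite addr_ge0// mulr_ge0// ltW.
  - rewrite [leRHS]mulrAC ler_pM2r ?invr_gt0//.
    by rewrite !ge_min lexx orbT.
  - rewrite [X in _ <= X / _]mulrAC [leRHS]mulrAC ler_pM2r ?invr_gt0//.
    by rewrite !ge_min lexx !orbT.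
rewrite -ler_pdivrMr// {2}/beta_par tE !le_min; apply/and3P; split.
- by rewrite [leRHS]mulrAC ler_pM2r ?invr_gt0// /beta_par ge_min lexx.
- apply: (@le_trans _ _ ((50 * lam)^-1 / s)).
    by rewrite ler_pM2r ?invr_gt0// /beta_par !ge_min lexx orbT.
  by apply: mono; rewrite invr_ge0 mulr_ge0// ltW.
- have q0 : 0 < (36 * mu * sbar ^+ 2)^-1.
    by rewrite invr_gt0.
  apply: (@le_trans _ _ (eta 1 / (36 * mu * sbar ^+ 2) / s)).
    by rewrite ler_pM2r ?invr_gt0// /beta_par !ge_min lexx !orbT.
  by rewrite mulrAC ler_pM2r.
Qed.

End StepSizes.

Lemma queries_run {R : realType} {n m k : nat} (A : 'M[R]_(m, n)) b (H : 'M[R]_(k, n)) h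
    {S : Type} (F : 'cV[R]_n -> S -> 'cV[R]_n) rho mu tau eta beta x0 y0 samples t :
  queries (run A b H h F rho mu tau eta beta x0 y0 samples t) = t.
Proof. by elim: t => //= t; case: run => x y z q /= ->. Qed.

Lemma smooth_const_ge0 {R : realType} {n : nat} (Lf : R) (f : 'cV[R]_n -> R) :
  (0 < n)%N -> smooth Lf f -> 0 <= Lf.
Proof.
case: n f => // n f _ [_ /(_ (delta_mx ord0 0) 0)]; rewrite subr0 => le.
have : 0 <= Lf * enorm (delta_mx ord0 0 : 'cV[R]_n.+1) by exact: le_trans (enorm_ge0 _) le.
rewrite pmulr_lge0// lt_def enorm_ge0 andbT.
apply/eqP => /enorm_eq0 /matrixP /(_ ord0 0); rewrite !mxE eqxx => /eqP.
by rewrite oner_eq0.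
Qed.

(** Since beta t >= b1 s, the threshold on s is the solution of mu M / (eps b1 s) <= eps / 2. *)
Lemma rate_bound {R : realFieldType} (mu M b1 beta s t x eps : R) :
  0 < mu -> 0 < b1 -> 0 < beta -> 0 < t -> 0 < eps -> 0 <= s ->
  b1 <= beta * s -> s ^+ 2 = t -> 2 * mu * M / b1 * eps ^- 2 <= s -> x <= M ->
  eps / 2 + mu / (eps * beta) / t * x <= eps.
Proof.
move=> mu0 b10 beta0 t0 eps0 s0 b1s sE qs xM.
have e2 : 0 < eps ^+ 2 by exact: exprn_gt0.
have muM : 2 * mu * M <= eps ^+ 2 * (beta * t).
  move: qs; rewrite ler_pdivrMr// ler_pdivrMr// => /le_trans; apply.
  have -> : s * eps ^+ 2 * b1 = eps ^+ 2 * s * b1 by ring.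
  have -> : eps ^+ 2 * (beta * t) = eps ^+ 2 * s * (beta * s) by rewrite -sE; ring.
  by rewrite ler_wpM2l// mulr_ge0// ltW.
suff : mu / (eps * beta) / t * x <= eps / 2 by move: (mu / _ / _ * _) => *; lra.
have -> : mu / (eps * beta) / t * x = mu * x / (eps * beta * t).
  by field; rewrite !lt0r_neq0.
rewrite ler_pdivrMr ?mulr_gt0//.
have : mu * x <= mu * M by rewrite ler_pM2l.
have -> : eps / 2 * (eps * beta * t) = eps ^+ 2 * (beta * t) / 2 by field.
by move: muM; rewrite -mulrA; move: (mu * M) (mu * x) (eps ^+ 2 * _) => *; lra.
Qed.

Theorem theorem3p1 (R : realType) (n m k : nat)
    (f : 'cV[R]_n -> R) (A : 'M[R]_(m, n)) (b : 'cV[R]_m)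
    (H : 'M[R]_(k, n)) (h : 'cV[R]_k)
    (Lf flow sigma rho sbar : R) (x0 : 'cV[R]_n) (y0 : 'cV[R]_m)
    (hA : A != 0)
    (hfeas : feasible A b H h !=set0)
    (hsmooth : smooth Lf f)
    (hflow : forall x, feasible A b H h x -> flow <= f x)
    (hrho : 0 <= rho)
    (hsbar0 : 0 < sbar)
    (hsbar : error_bound f A b H h rho (mu_par Lf) sbar)
    (hx0 : polyhedron H h x0) :
  exists C C' : R, [/\ 0 < C, 0 < C' &
    forall (dS : measure_display) (S : measurableType dS)
      (Xi : probability S R) (F : 'cV[R]_n -> S -> 'cV[R]_n),
    stochastic_oracle f sigma Xi F ->
    forall eps : R, 0 < eps <= 1 ->
    let T := `|Num.ceil (C * eps ^- 4)|%N in
    forall (d : measure_display) (Omega : measurableType d)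
      (P : probability Omega R)
      (xi : nat -> {RV P >-> S}) (tstar : {RV P >-> nat}),
    iid T xi Xi ->
    uniform_index T tstar ->
    independent_of_samples T tstar xi ->
    let st (w : Omega) := run A b H h F rho (mu_par Lf)
      (tau_par A Lf rho T) (eta_par A Lf rho T) (beta_par A Lf rho sbar T)
      x0 y0 (fun t => xi t w) in
    let Psi := moreau f A b H h (mu_par Lf) in
    let gradnorm (w : Omega) := enorm (grad Psi (zs (st w (tstar w)))) in
    [/\ forall z, differentiable Psi z,
        measurable_fun [set: Omega] gradnorm,
        ('E_P[gradnorm] <= eps%:E)%E,
        C * eps ^- 4 <= T%:R <= C' * eps ^- 4 &
        forall w, (queries (st w T))%:R <= C' * eps ^- 4]].
Proof.
(* A nonzero matrix has a column, and a nonzero vector is what forces the Lipschitz constant to be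
   nonnegative. *)
have n_gt0 : (0 < n)%N.
  case: n A {f H x0 hfeas hsmooth hflow hsbar hx0} hA => // A0 /eqP []; apply/matrixP => i [] //.
have Lf_ge0 := smooth_const_ge0 n_gt0 hsmooth.
have mu2 := mu_par_ge2 Lf; have mu4 := mu_par_ge4 Lf.
have mu0 : 0 < mu_par Lf by exact: lt_le_trans (ltr0Sn R 1) mu2.
(* Initial gap plus a bound on the total noise valid for every T, so the constants are fixed before
   eps and the oracle. *)
pose M := potential f A b H h rho (mu_par Lf) x0 y0 x0 - flow + sigma ^+ 2.
have M0 : 0 <= M.
  apply: addr_ge0; last exact: sqr_ge0.
  by rewrite subr_ge0; exact: (flow_le_potential hfeas hsmooth hrho mu2 mu4 hflow).
pose b1 := beta_par A Lf rho sbar 1.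
have b10 : 0 < b1 by exact: beta_par_gt0.
pose q := 2 * mu_par Lf * M / b1.
have q0 : 0 <= q by apply: divr_ge0 (ltW b10); apply: mulr_ge0 => //; exact/ltW/mulr_gt0.
(* C >= q^2 yields sqrt T >= q eps^-2. The first unit keeps C positive when q = 0; the second pays
   for rounding up, as eps^-4 >= 1. *)
exists (q ^+ 2 + 1), (q ^+ 2 + 2); split; [by rewrite ltr_wpDl ?sqr_ge0..|].
move=> dS S Xi F oracle eps /andP[eps0 eps1] T d Omega P xi tstar hiid hunif hind st Psi gradnorm.
pose C := q ^+ 2 + 1.
have C0 : 0 < C by rewrite ltr_wpDl ?sqr_ge0.
have e4 : 1 <= eps ^- 4 by rewrite -invr1 lef_pV2 ?posrE ?exprn_gt0// exprn_ile1// ltW.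
have Ce0 : 0 < C * eps ^- 4 by rewrite mulr_gt0// invr_gt0 exprn_gt0.
have ceil0 : 0 < Num.ceil (C * eps ^- 4) by rewrite ceil_gt0.
have TE : T%:R = (Num.ceil (C * eps ^- 4))%:~R :> R by rewrite /T natr_absz gtr0_norm.
have T_ge : C * eps ^- 4 <= T%:R by rewrite TE ceil_ge.
have T_le : T%:R <= (q ^+ 2 + 2) * eps ^- 4.
  have : T%:R - 1 < C * eps ^- 4.
    by have := ceilB1_lt (C * eps ^- 4); rewrite intrB -TE.
  by rewrite /C; move: (q ^+ 2) (eps ^- 4) e4 (T%:R) => *; lra.
have T0 : (0 < T)%N by rewrite -(ltr0n R); exact: lt_le_trans T_ge.
have oA2 := eta_par_opnorm Lf rho hA T.
have [mg Eg] := expected_gradnorm (d := d) hfeas hsmooth hrho Lf_ge0 mu2 mu4 hsbar oracle hflow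
  (tau_par_gt0 A Lf_ge0 hrho T0) (tau_par_lambda A Lf_ge0 hrho T0)
  (tau_par_p A Lf_ge0 hrho T0) (eta_par_gt0 hA Lf_ge0 hrho T0) oA2
  (beta_par_gt0 hA Lf_ge0 hrho hsbar0 T0) (beta_par_tau A Lf rho sbar T)
  (beta_par_1 A sbar Lf_ge0 hrho T) (beta_par_eta A Lf rho hsbar0 T)
  hiid x0 y0 T0 eps0 hunif hind.
split => //.
- by move=> z; case: (moreau_grad hfeas hsmooth Lf_ge0 (Lf_lt_mu mu2 mu4) z).
- rewrite unlock; apply: le_trans Eg _; rewrite lee_fin.
  have sT : Num.sqrt (T%:R : R) ^+ 2 = T%:R by rewrite sqr_sqrtr.
  apply: (rate_bound (s := Num.sqrt T%:R) (b1 := b1) (M := M)) => //.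
  - exact: beta_par_gt0.
  - by rewrite ltr0n.
  - exact: beta_par_lower.
  - have qe0 : 0 <= q * eps ^- 2 by rewrite mulr_ge0// invr_ge0 exprn_ge0// ltW.
    rewrite -(ler_pXn2r (n := 2))// ?nnegrE// ?sqrtr_ge0// sT exprMn exprVn -exprM.
    apply: le_trans T_ge; apply: ler_wpM2r; first exact: le_trans e4.
    by rewrite /C lerDl.
  - rewrite lerD2l; apply: (tau_par_total A Lf_ge0 hrho T0); exact: sqr_ge0.
- by rewrite T_ge.
- by move=> w; rewrite queries_run.
Qed.
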